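(* Let $\Gamma\subseteq\Phi_+$ and $x\in W$. Then: (a) $\overline{\Gamma}=\Phi_x$ if and only if $\Phi_{x,-1}\subseteq\Gamma\subseteq\Phi_x$. (b) $\overline{\Gamma}=\Phi'_x$ if and only if $\Phi_{x,1}\subseteq\Gamma\subseteq\Phi'_x$.
   Context: Setting: $V$ is a real vector space with a symmetric bilinear form $\langle\cdot,\cdot\rangle$ and $\Pi\subseteq V$ is a set (the simple roots, possibly infinite) such that (i) $\Pi$ is positively independent (if a finite sum $\sum_{\alpha\in\Pi}c_\alpha\alpha=0$ with all $c_\alpha\geq 0$, then all $c_\alpha=0$); (ii) $\langle\alpha,\alpha\rangle=1$ for $\alpha\in\Pi$, and $\langle\alpha,\beta\rangle\in\{-\cos(\pi/m)\mid m\in\mathbb{Z}_{\geq 2}\}\cup(-\infty,-1]$ for distinct $\alpha,\beta\in\Pi$. For $\alpha\in V$ with $\langle\alpha,\alpha\rangle=1$, let $s_\alpha(v)=v-2\langle v,\alpha\rangle\alpha$. Then $S=\{s_\alpha\mid\alpha\in\Pi\}$, $W=\langle S\rangle$ is a Coxeter group with Coxeter system $(W,S)$ and length function $l$. The root system is $\Phi=W\Pi$; the positive roots $\Phi_+$ are the roots that are non-negative real linear combinations of $\Pi$; $\Phi_-=-\Phi_+$, and $\Phi$ is the disjoint union of $\Phi_+$ and $\Phi_-$. For $x\in W$, $\Phi_x:=\Phi_+\cap x(\Phi_-)=\{\alpha\in\Phi_+\mid l(s_\alpha x)<l(x)\}$ and $\Phi'_x:=\Phi_+\setminus\Phi_x$.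 For $n\in\mathbb{Z}$ and $x\in W$, $\Phi_{x,n}:=\{\alpha\in\Phi_+\mid l(s_\alpha x)=l(x)+n\}$. 2-closure: a subset $\Gamma$ of $\Phi$ is closed if for all $\alpha,\beta\in\Gamma$, $\{a\alpha+b\beta\mid a,b\in\mathbb{R}_{\geq0}\}\cap\Phi\subseteq\Gamma$. For $\Gamma\subseteq\Phi$, $\overline{\Gamma}$ is the intersection of all closed subsets of $\Phi$ containing $\Gamma$. *)

(* Defs.v *)
From HB Require Import structures.
From mathcomp Require Import all_boot all_order all_algebra finmap.
From mathcomp Require Import all_classical all_reals all_analysis.

Set Implicit Arguments.
Unset Strict Implicit.
Unset Printing Implicit Defensive.

Import Order.TTheory GRing.Theory Num.Theory.

Local Open Scope classical_set_scope.
Local Open Scope ring_scope.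

Section RootSystems.
Variables (R : realType) (V : lmodType R).
Variables (B : {symmetric V}) (Pi : set V).

Definition positively_independent :=
  forall (A : {fset V}) (c : V -> R),
    [set` A] `<=` Pi -> (forall a, a \in A -> 0 <= c a) ->
    \sum_(a <- A) c a *: a = 0 -> forall a, a \in A -> c a = 0.

Definition simple_roots :=
  [/\ positively_independent,
      forall a, Pi a -> B a a = 1
    & forall a b, Pi a -> Pi b -> a <> b ->
        (exists2 m : nat, (2 <= m)%N & B a b = - cos (pi / m%:R)) \/
        B a b <= -1].

Definition refl (a v : V) : V := v - (2 * B v a) *: a.

Definition simple_refls : set (V -> V) := [set refl a | a in Pi].

Definition bijection_group (G : set (V -> V)) :=
  [/\ forall g, G g -> bijective g,
      G id,
      forall g h, G g -> G h -> G (g \o h)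
    & forall g h, G g -> cancel g h -> cancel h g -> G h].

Definition weyl : set (V -> V) := smallest bijection_group simple_refls.

Definition has_word (w : V -> V) (n : nat) :=
  exists s : seq V,
    [/\ size s = n, forall a, a \in s -> Pi a
      & w = foldr comp id [seq refl a | a <- s]].

(* The value 0 in the second branch is irrelevant: elements of [weyl] always
   have a word, since the simple reflections are involutions. *)
Definition len (w : V -> V) : nat :=
  match pselect (exists n, `[< has_word w n >]) with
  | left ex => ex_minn ex
  | right _ => 0%N
  end.

Definition root_system : set V := [set v | exists w a, [/\ weyl w, Pi a & v = w a]].

Definition nonneg_comb (v : V) :=
  exists (A : {fset V}) (c : V -> R),
    [/\ [set` A] `<=` Pi, forall a, a \in A -> 0 <= c a
      & v = \sum_(a <- A) c a *: a].

Definition pos_roots : set V := [set v | root_system v /\ nonneg_comb v].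

Definition neg_roots : set V := [set - v | v in pos_roots].

Definition inversions (x : V -> V) : set V := pos_roots `&` x @` neg_roots.

Definition noninversions (x : V -> V) : set V := pos_roots `\` inversions x.

Definition len_shift_roots (x : V -> V) (n : int) : set V :=
  [set a | pos_roots a /\ (len (refl a \o x))%:Z = (len x)%:Z + n].

Definition two_closed (G : set V) :=
  G `<=` root_system /\
  forall a b, G a -> G b -> forall s t : R, 0 <= s -> 0 <= t ->
    root_system (s *: a + t *: b) -> G (s *: a + t *: b).

Definition two_closure (G : set V) : set V := smallest two_closed G.

End RootSystems.

(* Main.v *)
Require Import Defs.
From HB Require Import structures.
From mathcomp Require Import all_boot all_order all_algebra finmap.
From mathcomp Require Import ring lra zify.
From mathcomp Require Import all_classical all_reals all_analysis.

(** Write [l] for the length and [s v] for the reflection in a root [v]. Inversions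
    and non-inversions of [x] both form closed sets, so each half of the theorem
    is a statement about generators of a closed set [A] ([closure_eqP]): no root
    that changes the length by exactly one may lie in the cone of two other roots
    of [A], and every root of [A] must be reached from such roots.

    Both facts come from planes. The positive roots of a plane lie in the cone of
    two of them ([plane_basis]); these two generate a dihedral reflection subgroup
    that contains the reflections in all roots of the plane ([plane_pos]), and
    they form a root basis of their own ([pair_basis]), so the theory of lengths
    and inversions applies to them verbatim. An element [x] is a product [g u] with
    [g] in the subgroup and [u] dominant, and the ambient length on the coset is
    strictly increasing in the dihedral length ([coset_len_lt]). In a dihedral
    group all is explicit because reduced words alternate: an inversion of [g] that
    changes the dihedral length by one is a wall of the chamber of [g]
    ([adjacent_refl_wall]), walls do not lie between other inversions
    ([wall_not_between]), and every other inversion lies in the cone of two walls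
    ([descend_between]); likewise for non-inversions ([ascend_between]). Hence a root [v] of [A] that lies between two others is in
    the cone of two roots of [A] whose reflections change the length of [x]
    strictly less than [s v] does ([inversion_step], [noninversion_step]). This
    excludes roots with length change one, and makes an induction terminate.

    It remains to see that an inversion [v] with [l (s v x) < l x - 1] does lie
    between two other inversions ([inversion_between]). Along a left descent [a]
    of [x] one either passes to the shorter element [s a x], or finds that [v] is
    a positive multiple of the sum of the inversions [a] and [- s v a]. For
    non-inversions the same lemma is applied to [s v x].

    All this rests on two facts about simple roots that are only positively
    independent. Every root is positive or negative ([cone_or_opp]); this is the
    usual induction over minimal coset representatives of dihedral subgroups, in
    which the coordinates of roots are Chebyshev numbers and the angles
    [pi / m] yield the braid relations. And simple roots are extremal
    ([simple_extremal]), by pairing with the form. The deletion property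
    ([deletion]) then ties inversions to lengths. *)

Set Implicit Arguments.
Unset Strict Implicit.
Unset Printing Implicit Defensive.

Import Order.TTheory GRing.Theory Num.Theory.

Local Open Scope classical_set_scope.
Local Open Scope ring_scope.

(** * Linear identities between vectors *)
Section VecTactic.
Variables (R : comPzRingType) (V : lmodType R).

(** Syntax of the linear expressions over a list of atoms, the target of a
    reflexive proof: two expressions are equal as soon as they have the same
    coefficient at every atom. *)
Inductive vexp :=
  | VAtom of nat | VZero | VAdd of vexp & vexp | VOpp of vexp
  | VScale of R & vexp.

Fixpoint veval (env : seq V) e : V :=
  match e with
  | VAtom i => nth 0 env i
  | VZero => 0
  | VAdd e1 e2 => veval env e1 + veval env e2
  | VOpp e1 => - veval env e1
  | VScale c e1 => c *: veval env e1
  end.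

Fixpoint vcoef e (i : nat) : R :=
  match e with
  | VAtom j => if i == j then 1 else 0
  | VZero => 0
  | VAdd e1 e2 => vcoef e1 i + vcoef e2 i
  | VOpp e1 => - vcoef e1 i
  | VScale c e1 => c * vcoef e1 i
  end.

Lemma vevalE env e : veval env e = \sum_(i < size env) vcoef e i *: env`_i.
Proof.
elim: e => /= [j||e1 -> e2 ->|e1 ->|c e1 ->].
- case: (ltnP j (size env)) => jn; last first.
    rewrite nth_default // big1 // => i _; case: eqP => [ij|]; last by rewrite scale0r.
    by move: (ltn_ord i); rewrite ij ltnNge jn.
  rewrite (bigD1 (Ordinal jn)) //= eqxx scale1r big1 ?addr0 // => i.
  by rewrite -val_eqE /= => /negbTE ->; rewrite scale0r.
- by rewrite big1 // => i _; rewrite scale0r.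
- by rewrite -big_split; apply: eq_bigr => i _; rewrite scalerDl.
- by rewrite -sumrN; apply: eq_bigr => i _; rewrite scaleNr.
- by rewrite scaler_sumr; apply: eq_bigr => i _; rewrite scalerA.
Qed.

(** A conjunction over the atoms rather than a quantification over indices, so
    that it computes to one closed scalar equation per atom. *)
Fixpoint vsame (n : nat) e1 e2 : Prop :=
  if n is n'.+1 then vsame n' e1 e2 /\ vcoef e1 n' = vcoef e2 n' else True.

Lemma veval_eq env e1 e2 :
  vsame (size env) e1 e2 -> veval env e1 = veval env e2.
Proof.
rewrite !vevalE; elim: (size env) => [|n IH] /=; first by rewrite !big_ord0.
by move=> [/IH e12 e]; rewrite !big_ord_recr /= e12 e.
Qed.
End VecTactic.

Ltac vindex x env :=
  lazymatch env with
  | x :: _ => constr:(0%N)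
  | _ :: ?env' => let i := vindex x env' in constr:(i.+1)
  end.

Ltac vreify R V env t :=
  lazymatch t with
  | (?x + ?y)%R => let a := vreify R V env x in let b := vreify R V env y in
                   constr:(@VAdd R a b)
  | (- ?x)%R => let a := vreify R V env x in constr:(@VOpp R a)
  | (?c *: ?x)%R => let a := vreify R V env x in constr:(@VScale R c a)
  | 0%R => constr:(@VZero R)
  | _ => let i := vindex t env in constr:(@VAtom R i)
  end.

(** [vec [:: u; v]] reduces an equality of linear combinations of [u] and [v]
    to the equality of their coefficients and calls [ring] on each; what [ring]
    cannot do, such as an identity with inverses, is left to the caller. *)
Ltac vec env :=
  lazymatch type of env with
  | seq (GRing.Lmodule.sort ?V) =>
  lazymatch type of V with GRing.Lmodule.type ?R =>
  lazymatch goal with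
  | |- @eq _ ?l ?r =>
    let a := vreify R V env l in let b := vreify R V env r in
    refine (@veval_eq R V env a b _); simpl; repeat split end end; try ring
  end.

(** * Reflections *)
Section Reflections.
Variables (R : realType) (V : lmodType R) (B : {symmetric V}).
Implicit Types (Pi : set V) (a b c u v w : V) (k p q : R).

Local Notation rf := (refl B).

Lemma bformC u v : B u v = B v u.
Proof. by rewrite [LHS](@hermitian_subproof _ _ _ _ B) expr0 mul1r. Qed.

Lemma bformDl u v w : B (u + v) w = B u w + B v w.
Proof. exact: linearDl. Qed.

Lemma bformZl k u w : B (k *: u) w = k * B u w.
Proof. exact: linearZl_LR. Qed.

Lemma bformNl u w : B (- u) w = - B u w.
Proof. exact: linearNl. Qed.

Lemma bformDr u v w : B w (u + v) = B w u + B w v.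
Proof. by rewrite !(bformC w) bformDl. Qed.

Lemma bformZr k u w : B w (k *: u) = k * B w u.
Proof. by rewrite !(bformC w) bformZl. Qed.

Lemma bformNr u w : B w (- u) = - B w u.
Proof. by rewrite !(bformC w) bformNl. Qed.

Definition bformE := (bformDl, bformDr, bformZl, bformZr, bformNl, bformNr).

Lemma reflD a u v : rf a (u + v) = rf a u + rf a v.
Proof. by rewrite /refl bformDl; vec [:: a; u; v]. Qed.

Lemma reflZ a k v : rf a (k *: v) = k *: rf a v.
Proof. by rewrite /refl bformZl; vec [:: a; v]. Qed.

Lemma reflN a v : rf a (- v) = - rf a v.
Proof. by rewrite -scaleN1r reflZ scaleN1r. Qed.

Lemma refl_opp a : rf (- a) = rf a.
Proof. by apply: funext => v; rewrite /refl bformNr; vec [:: a; v]. Qed.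

Lemma refl_self a : B a a = 1 -> rf a a = - a.
Proof. by move=> aa; rewrite /refl aa; vec [:: a]. Qed.

Lemma reflK a : B a a = 1 -> involutive (rf a).
Proof.
move=> aa v; rewrite /refl !bformE aa; vec [:: a; v].
Qed.

Lemma bform_refl a u v : B a a = 1 -> B (rf a u) (rf a v) = B u v.
Proof. move=> aa; rewrite /refl !bformE aa (bformC a v); ring. Qed.

End Reflections.

(** * Words, the group they form, and length *)
Section Words.
Variables (R : realType) (V : lmodType R) (B : {symmetric V}) (Pi : set V).
Implicit Types (a b c u v : V) (k p q : R) (s t : seq V) (w x y g h : V -> V).

Local Notation rf := (refl B).
Local Notation W := (weyl B Pi).
Local Notation root := (root_system B Pi).

Definition word_eval s : V -> V := foldr comp id [seq rf a | a <- s].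

Definition word s := forall a, a \in s -> Pi a.

(** Group elements are bare functions, so their inverses are obtained by
    choice; the value outside the range of [w] is never used. *)
Definition winv w v : V := xget 0 [set u | w u = v].

Lemma word_eval_cons a s : word_eval (a :: s) = rf a \o word_eval s.
Proof. by []. Qed.

Lemma word_eval_cat s t : word_eval (s ++ t) = word_eval s \o word_eval t.
Proof. by elim: s => //= a s IH; rewrite /word_eval /= -/(word_eval _) IH. Qed.

Lemma word_nil : word [::].
Proof. by []. Qed.

Lemma word_cons a s : word (a :: s) <-> Pi a /\ word s.
Proof.
split=> [h|[Pa ws] b]; last by rewrite inE => /predU1P[->|/ws].
by split=> [|b bs]; apply: h; rewrite inE ?eqxx ?bs ?orbT.
Qed.

Lemma word_cat s t : word (s ++ t) <-> word s /\ word t.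
Proof.
split=> [h|[ws wt] a]; last by rewrite mem_cat => /orP[/ws|/wt].
by split=> a ai; apply: h; rewrite mem_cat ai ?orbT.
Qed.

Lemma word_rev s : word (rev s) <-> word s.
Proof. by split=> h a; [rewrite -mem_rev|rewrite mem_rev] => /h. Qed.

Hypothesis norm1 : forall a, Pi a -> B a a = 1.

Lemma word_evalD s u v : word_eval s (u + v) = word_eval s u + word_eval s v.
Proof. by elim: s => //= a s IH; rewrite /word_eval /= -/(word_eval _) IH reflD. Qed.

Lemma word_evalZ s k v : word_eval s (k *: v) = k *: word_eval s v.
Proof. by elim: s => //= a s IH; rewrite /word_eval /= -/(word_eval _) IH reflZ. Qed.

Lemma word_eval_form s u v : word s ->
  B (word_eval s u) (word_eval s v) = B u v.
Proof.
elim: s => //= a s IH /word_cons[/norm1 aa /IH <-].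
by rewrite /word_eval /= bform_refl.
Qed.

Lemma word_evalK s : word s -> cancel (word_eval s) (word_eval (rev s)).
Proof.
elim: s => //= a s IH /word_cons[/norm1 aa /IH sK] v.
rewrite rev_cons -cats1 word_eval_cat /word_eval /= reflK //; exact: sK.
Qed.

Lemma word_eval_revK s : word s -> cancel (word_eval (rev s)) (word_eval s).
Proof. by move=> /word_rev /word_evalK; rewrite revK. Qed.

(** Simple reflections are involutions, so reversing a word inverts it and the
    values of the words already form a group of bijections. *)
Lemma weylP w : W w <-> exists2 s, word s & w = word_eval s.
Proof.
split=> [|[s ws ->] G /= [[_ Gid Gcomp _] GS]]; last first.
  elim: s ws => //= a s IH /word_cons[Pa /IH Gs].
  by apply: Gcomp => //; apply: GS; exists a.
pose G := [set w | exists2 s, word s & w = word_eval s].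
have GG : bijection_group G.
  split=> [_ [s ws ->]||_ _ [s ws ->] [t wt ->]|_ h [s ws ->] gh hg].
  - by exists (word_eval (rev s)); [exact: word_evalK|exact: word_eval_revK].
  - by exists [::].
  - by exists (s ++ t); rewrite ?word_eval_cat //; apply/word_cat.
  exists (rev s); first exact/word_rev.
  by apply: funext => v; rewrite -{1}(word_eval_revK ws v) gh.
move=> /(_ G); apply; split=> // _ [a Pa <-]; exists [:: a] => //.
by move=> b; rewrite inE => /eqP ->.
Qed.

Lemma weyl_word s : word s -> W (word_eval s).
Proof. by move=> ws; apply/weylP; exists s. Qed.

Lemma weyl_id : W id.
Proof. exact: (weyl_word word_nil). Qed.

Lemma weyl_comp g h : W g -> W h -> W (g \o h).
Proof.
move=> /weylP[s ws ->] /weylP[t wt ->]; rewrite -word_eval_cat.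
by apply: weyl_word; apply/word_cat.
Qed.

Lemma weyl_simple a : Pi a -> W (rf a).
Proof. by move=> Pa; apply: (weyl_word (s := [:: a])); apply/word_cons. Qed.

Lemma weylD w u v : W w -> w (u + v) = w u + w v.
Proof. by case/weylP=> s _ ->; rewrite word_evalD. Qed.

Lemma weylZ w k v : W w -> w (k *: v) = k *: w v.
Proof. by case/weylP=> s _ ->; rewrite word_evalZ. Qed.

Lemma weylN w v : W w -> w (- v) = - w v.
Proof. by move=> Ww; rewrite -scaleN1r weylZ // scaleN1r. Qed.

Lemma weyl_form w u v : W w -> B (w u) (w v) = B u v.
Proof. by case/weylP=> s ws ->; rewrite word_eval_form. Qed.

Lemma weyl_bij w : W w -> exists2 g, W g & cancel w g /\ cancel g w.
Proof.
case/weylP=> s ws ->; exists (word_eval (rev s)).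
  by apply: weyl_word; apply/word_rev.
by split; [exact: word_evalK|exact: word_eval_revK].
Qed.

Lemma winvE w g : cancel w g -> cancel g w -> winv w = g.
Proof.
move=> wg gw; apply: funext => v; rewrite /winv; case: xgetP => [u _ <-|/(_ (g v))].
  by rewrite wg.
by case; rewrite /= gw.
Qed.

Lemma weyl_inv w : W w -> W (winv w).
Proof. by case/weyl_bij=> g Wg [wg gw]; rewrite (winvE wg gw). Qed.

Lemma weylK w : W w -> cancel w (winv w).
Proof. by case/weyl_bij=> g Wg [wg gw]; rewrite (winvE wg gw). Qed.

Lemma weylVK w : W w -> cancel (winv w) w.
Proof. by case/weyl_bij=> g Wg [wg gw]; rewrite (winvE wg gw). Qed.

Lemma winv_comp g h : W g -> W h -> winv (g \o h) = winv h \o winv g.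
Proof.
move=> Wg Wh; apply: winvE => v /=; first by rewrite !weylK.
by rewrite !weylVK.
Qed.

Lemma winv_refl a : B a a = 1 -> winv (rf a) = rf a.
Proof. by move=> aa; apply: winvE; exact: reflK. Qed.

Lemma refl_weyl w u v : W w -> rf (w u) (w v) = w (rf u v).
Proof.
by move=> Ww; rewrite {1}/refl weyl_form // /refl (weylD _ _ Ww) (weylN _ Ww) (weylZ _ _ Ww).
Qed.

Lemma simple_root a : Pi a -> root a.
Proof. by move=> Pa; exists id, a; split=> //; exact: weyl_id. Qed.

Lemma root_norm v : root v -> B v v = 1.
Proof. by case=> w [a [Ww Pa ->]]; rewrite weyl_form // norm1. Qed.

Lemma weyl_root w v : W w -> root v -> root (w v).
Proof.
by move=> Ww [g [a [Wg Pa ->]]]; exists (w \o g), a; split=> //; exact: weyl_comp.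
Qed.

Lemma root_opp v : root v -> root (- v).
Proof.
case=> w [a [Ww Pa ->]]; rewrite -weylN // -(refl_self (norm1 Pa)).
by apply: weyl_root => //; apply: weyl_root (simple_root Pa); exact: weyl_simple.
Qed.

Lemma weyl_refl v : root v -> W (rf v).
Proof.
case=> w [a [Ww Pa ->]].
suff -> : rf (w a) = w \o (rf a \o winv w).
  by apply: weyl_comp => //; apply: weyl_comp; [exact: weyl_simple|exact: weyl_inv].
by apply: funext => v' /=; rewrite -refl_weyl // weylVK.
Qed.

Lemma refl_root u v : root u -> root v -> root (rf u v).
Proof. by move=> ru rv; apply: weyl_root => //; exact: weyl_refl. Qed.

Lemma refl_refl u v z : root u -> rf (rf u v) (rf u z) = rf u (rf v z).
Proof. by move=> ru; apply: refl_weyl; exact: weyl_refl. Qed.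

Lemma refl_cancel u x : root u -> rf u \o (rf u \o x) = x.
Proof. by move=> ru; apply: funext => v /=; rewrite reflK ?root_norm. Qed.

Lemma winv_refl_comp u x v : root u -> W x -> winv (rf u \o x) v = winv x (rf u v).
Proof.
by move=> ru Wx; rewrite winv_comp ?winv_refl ?root_norm //; exact: weyl_refl.
Qed.

Lemma len_has_word w n : has_word B Pi w n -> (len B Pi w <= n)%N /\
  exists s, [/\ word s, w = word_eval s & size s = len B Pi w].
Proof.
move=> wn; rewrite /len; case: pselect => [ex|]; last first.
  by case; exists n; apply/asboolP.
case: ex_minnP => m /asboolP[s [<- ws e]] mmin; split; last by exists s.
by apply: mmin; apply/asboolP.
Qed.

Lemma len_word s : word s -> (len B Pi (word_eval s) <= size s)%N.
Proof. by move=> ws; case: (@len_has_word (word_eval s) (size s)) => //; exists s. Qed.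

Lemma reduced_word w : W w ->
  exists s, [/\ word s, w = word_eval s & size s = len B Pi w].
Proof.
by case/weylP=> s ws e; case: (@len_has_word w (size s)) => //; exists s.
Qed.

Lemma len_simplel a w : Pi a -> W w -> (len B Pi (rf a \o w) <= (len B Pi w).+1)%N.
Proof.
move=> Pa /reduced_word[s [ws -> <-]].
by apply: (@len_word (a :: s)); apply/word_cons.
Qed.

Lemma len_simpler a w : Pi a -> W w -> (len B Pi (w \o rf a) <= (len B Pi w).+1)%N.
Proof.
move=> Pa /reduced_word[s [ws -> <-]].
have -> : word_eval s \o rf a = word_eval (s ++ [:: a]) by rewrite word_eval_cat.
rewrite -(addn1 (size s)) -(size_cat s [:: a]); apply: len_word.
by apply/word_cat; split=> //; apply/word_cons.
Qed.

End Words.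

(** * Non-negative combinations *)
Section Cones.
Variables (R : realType) (V : lmodType R) (Pi : set V).
Implicit Types (a b v w : V) (k : R).

Local Notation cone := (nonneg_comb Pi).

Lemma sum_fset_widen (A A' : {fset V}) (c : V -> R) : (A `<=` A')%fset ->
  \sum_(a <- A) c a *: a = \sum_(a <- A') (if a \in A then c a else 0) *: a.
Proof.
move=> AA'; rewrite -(big_fset_incl _ AA'); last first.
  by move=> a _ /negbTE ->; rewrite scale0r.
by apply: eq_big_seq => a ->.
Qed.

Lemma sum_fsetU (A A' : {fset V}) (c c' : V -> R) :
  \sum_(a <- A) c a *: a + \sum_(a <- A') c' a *: a =
  \sum_(a <- (A `|` A')%fset)
    ((if a \in A then c a else 0) + (if a \in A' then c' a else 0)) *: a.
Proof.
rewrite (sum_fset_widen c (fsubsetUl A A')) (sum_fset_widen c' (fsubsetUr A A')).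
by rewrite -big_split; apply: eq_bigr => a _; rewrite scalerDl.
Qed.

Lemma cone0 : cone 0.
Proof. by exists fset0, (fun=> 0); split=> //; rewrite big_seq_fset0. Qed.

Lemma coneD v w : cone v -> cone w -> cone (v + w).
Proof.
case=> A [c [AP c0 ->]] [A' [c' [AP' c0' ->]]]; rewrite sum_fsetU.
exists (A `|` A')%fset, (fun a =>
  (if a \in A then c a else 0) + (if a \in A' then c' a else 0)); split=> //.
  by move=> a /=; rewrite inE => /orP[/AP|/AP'].
by move=> a _; apply: addr_ge0; [case: ifP => // /c0|case: ifP => // /c0'].
Qed.

Lemma coneZ k v : 0 <= k -> cone v -> cone (k *: v).
Proof.
move=> k0 [A [c [AP c0 ->]]]; exists A, (fun a => k * c a); split=> //.
  by move=> a /c0; apply: mulr_ge0.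
by rewrite scaler_sumr; apply: eq_bigr => a _; rewrite scalerA.
Qed.

Lemma cone_simple a : Pi a -> cone a.
Proof.
move=> Pa; exists [fset a]%fset, (fun=> 1); split=> //.
  by move=> b /=; rewrite inE => /eqP ->.
by rewrite big_seq_fset1 scale1r.
Qed.

(** Induction over the convex cone spanned by [Pi]: it hides the finite supports
    and coefficient functions from all later arguments. *)
Lemma cone_ind (P : V -> Prop) : P 0 ->
  (forall a k v, Pi a -> 0 <= k -> P v -> P (k *: a + v)) ->
  forall v, cone v -> P v.
Proof.
move=> P0 PD v [A [c [AP c0 ->]]]; rewrite big_seq.
apply: (big_rec P) => // a v' aA Pv'; apply: PD => //; last exact: c0.
exact: AP.
Qed.

(** Adding the expressions of [v] and [- v] gives a vanishing combination whose
    coefficients dominate those of [v]. *)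
Lemma cone_pointed (indep : positively_independent Pi) v :
  cone v -> cone (- v) -> v = 0.
Proof.
case=> A [c [AP c0 ev]] [A' [c' [AP' c0' ev']]].
have s0 := sum_fsetU A A' c c'; rewrite -ev -ev' subrr in s0.
suff cA0 : forall a, a \in A -> c a = 0.
  by rewrite ev big_seq big1 // => a /cA0 ->; rewrite scale0r.
have ge0 a : 0 <= (if a \in A' then c' a else 0) by case: ifP => // /c0'.
have UP : [set` (A `|` A')%fset] `<=` Pi.
  by move=> a /=; rewrite inE => /orP[/AP|/AP'].
move=> a aA; have aU : a \in (A `|` A')%fset by rewrite inE aA.
have le0 b : 0 <= (if b \in A then c b else 0) by case: ifP => // /c0.
have := indep _ _ UP (fun b _ => addr_ge0 (le0 b) (ge0 b)) (esym s0) a aU.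
by rewrite aA => e; have := ge0 a; have := c0 _ aA; lra.
Qed.

End Cones.

(** * Chebyshev numbers *)
Section Chebyshev.
Variable (R : realType).
Implicit Types (c t : R) (n m : nat).

(** [cheb c n] is the value at [c] of the Chebyshev polynomial of the second
    kind of degree [n - 1]; these are the coordinates of the roots of a dihedral
    group whose two simple roots have inner product [- c]. *)
Fixpoint cheb c n : R :=
  match n with
  | 0 => 0
  | n'.+1 => match n' with 0 => 1 | n''.+1 => 2 * c * cheb c n' - cheb c n'' end
  end.

Lemma chebSS c n : cheb c n.+2 = 2 * c * cheb c n.+1 - cheb c n.
Proof. by []. Qed.

Lemma cheb_ge0 c n : 1 <= c -> 0 <= cheb c n <= cheb c n.+1.
Proof.
move=> c1; elim: n => [|n /andP[h0 h1]]; first by rewrite /= lexx ler01.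
by rewrite chebSS; apply/andP; split; nra.
Qed.

Lemma cheb_sin t n : cheb (cos t) n * sin t = sin (n%:R * t).
Proof.
suff: cheb (cos t) n * sin t = sin (n%:R * t) /\
      cheb (cos t) n.+1 * sin t = sin (n.+1%:R * t) by case.
elim: n => [|n [h0 h1]]; first by rewrite !mul0r sin0 !mul1r.
split=> //; transitivity (2 * cos t * sin (n.+1%:R * t) - sin (n%:R * t)).
  by rewrite -h0 -h1 chebSS mulrBl !mulrA.
have -> : n.+2%:R * t = n.+1%:R * t + t by rewrite -natr1; ring.
have -> : n%:R * t = n.+1%:R * t - t by rewrite -natr1; ring.
rewrite sinB sinD; ring.
Qed.

Lemma pi_div_nat m : (2 <= m)%N -> 0 < pi / m%:R :> R /\ pi / m%:R <= pi / 2 :> R.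
Proof.
move=> m2; have m0 : 0 < m%:R :> R by rewrite ltr0n; lia.
split; first by rewrite divr_gt0 ?pi_gt0.
rewrite ler_pM2l ?pi_gt0 // lef_pV2 ?posrE //.
by rewrite ler_nat.
Qed.

Lemma sin_pi_div_nat m : (2 <= m)%N -> 0 < sin (pi / m%:R : R).
Proof.
move=> /pi_div_nat[h0 h1]; apply: sin_gt0_pi; rewrite h0 /=.
by apply: le_lt_trans h1 _; have := pi_gt0 R; lra.
Qed.

Lemma cheb_cos_ge0 m n : (2 <= m)%N -> (n <= m)%N -> 0 <= cheb (cos (pi / m%:R : R)) n.
Proof.
move=> m2 nm; rewrite -(pmulr_lge0 _ (sin_pi_div_nat m2)) cheb_sin.
have m0 : 0 < m%:R :> R by rewrite ltr0n; lia.
apply: sin_ge0_pi; rewrite mulrCA; apply/andP; split.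
  by rewrite mulr_ge0 ?pi_ge0 // divr_ge0.
by rewrite ler_piMr ?pi_ge0 // ler_pdivrMr // mul1r ler_nat.
Qed.

(** These two values are the numerical content of the braid relation of
    length [m]. *)
Lemma cheb_cos_end m : (2 <= m)%N ->
  cheb (cos (pi / m%:R : R)) m = 0 /\ cheb (cos (pi / m%:R : R)) m.-1 = 1.
Proof.
move=> m2; have s0 := sin_pi_div_nat m2.
have m0 : m%:R != 0 :> R by rewrite pnatr_eq0; lia.
have e : m%:R * (pi / m%:R) = pi :> R by rewrite mulrCA divff ?mulr1.
split; apply: (mulIf (lt0r_neq0 s0)); rewrite cheb_sin.
  by rewrite e sinpi mul0r.
have -> : m.-1%:R * (pi / m%:R) = pi - pi / m%:R :> R.
  have h : (m.-1%:R + 1) * (pi / m%:R) = pi :> R by rewrite natr1 prednK //; lia.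
  by rewrite -[X in _ = X - _]h; ring.
by rewrite sinB sinpi cospi; ring.
Qed.

End Chebyshev.

Arguments cheb : simpl never.

(** * Every root is positive or negative *)
Section DihedralWords.
Variables (R : realType) (V : lmodType R) (B : {symmetric V}) (a b : V).
Hypotheses (aa : B a a = 1) (bb : B b b = 1).

Local Notation rf := (refl B).
Local Notation ev := (word_eval B).
Local Notation ab := (word [set a; b]).
Local Notation c := (- B a b).

Let letter n := if odd n then a else b.

(** The alternating word of length [n] in [a] and [b] whose last letter is
    [b]. *)
Fixpoint altword n : seq V := if n is n'.+1 then letter n' :: altword n' else [::].

Lemma size_altword n : size (altword n) = n.
Proof. by elim: n => //= n ->. Qed.

Lemma altword_word n : ab (altword n).
Proof.
elim: n => //= n IH; apply/word_cons; split=> //.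
by rewrite /letter; case: odd; [left|right].
Qed.

Lemma altword_eval n :
  ev (altword n) a = if odd n then cheb c n *: a + cheb c n.+1 *: b
                     else cheb c n.+1 *: a + cheb c n *: b.
Proof.
elim: n => [|n IH]; first by rewrite /cheb /= scale1r scale0r addr0.
rewrite [altword _]/= word_eval_cons /= IH /letter (chebSS c n).
move: (cheb c n.+1) (cheb c n) => p q.
case: (odd n); rewrite /refl !bformE ?aa ?bb ?(bformC B b a) /=; vec [:: a; b].
Qed.

Variable u : seq V.
Hypotheses (abu : ab u)
  (ured : forall u', ab u' -> ev u' = ev u -> (size u <= size u')%N)
  (uared : forall u', ab u' -> ev u' = ev u \o rf a -> (size u <= size u')%N).

(** Reading [u] from its last letter: the first letter read is not [a] by the
    second minimality assumption, and no letter is repeated by the first one. *)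
Lemma reduced_altword : ev u = ev (altword (size u)).
Proof.
elim: u abu ured uared => [//|d u' IH] /word_cons[abd abu'] red redA.
have e : ev u' = ev (altword (size u')).
  apply: IH => // t abt et.
    by apply: (red (d :: t)); [exact/word_cons|rewrite !word_eval_cons et].
  by apply: (redA (d :: t)); [exact/word_cons|rewrite !word_eval_cons et].
suff -> : d = letter (size u') by rewrite word_eval_cons e.
case: (eqVneq d (letter (size u'))) => // nd; exfalso.
have dd : B d d = 1 by case: abd => ->.
case en: (size u') e nd => [|n] e nd.
  have da : d = a by case: abd nd => -> //; rewrite eqxx.
  suff: (size (d :: u') <= 0)%N by []; apply: (redA [::]) => //.
  by apply: funext => v; rewrite word_eval_cons e /= da reflK.
have dn : d = letter n.
  by case: abd nd => ->; rewrite /letter /=; case: odd; rewrite ?eqxx.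
have := red (altword n) (@altword_word n).
rewrite /= size_altword en; suff h : ev (altword n) = ev (d :: u').
  by move=> /(_ h); lia.
rewrite word_eval_cons e /= word_eval_cons -dn.
by apply: funext => v /=; rewrite reflK.
Qed.

Hypothesis ab_cos :
  (exists2 m : nat, (2 <= m)%N & c = cos (pi / m%:R)) \/ 1 <= c.

(** The word of length [m - 1] maps [a] to the letter that would extend the
    word, so it conjugates the reflection in [a] to the reflection in that
    letter: this is the braid relation. *)
Lemma altword_end m : (2 <= m)%N -> c = cos (pi / m%:R) ->
  ev (altword m) = ev (altword m.-1) \o rf a.
Proof.
move=> m2 cm; have [p0 p1] := cheb_cos_end R m2.
have := altword_eval m.-1; rewrite cm prednK ?(ltn_trans _ m2) // p0 p1.
rewrite !scale1r !scale0r addr0 add0r => e.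
have {}e : ev (altword m.-1) a = letter m.-1 by rewrite e /letter; case: odd.
have em : altword m = letter m.-1 :: altword m.-1 by case: (m) m2.
have nab x : [set a; b] x -> B x x = 1 by case=> ->.
apply: funext => v; rewrite em word_eval_cons /= -e.
by rewrite (refl_weyl nab) //; apply: weyl_word => //; exact: altword_word.
Qed.

(** Otherwise [u] ends with the alternating word of length [m], which the braid
    relation rewrites so that it ends in [a], against the second minimality
    assumption. *)
Lemma reduced_altword_small m : (2 <= m)%N -> c = cos (pi / m%:R) ->
  (size u < m)%N.
Proof.
move=> m2 cm; rewrite ltnNge; apply/negP => mu.
have [s [abs es ss]] : exists s, [/\ ab s, ev (altword (size u)) = ev (s ++ altword m)
    & size s = size u - m]%N.
  rewrite -{1}(subnK mu); elim: (size u - m)%N => [|n [s [abs es ss]]].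
    by exists [::].
  exists (letter (n + m) :: s); split=> /=; last by rewrite ss; lia.
    by apply/word_cons; split=> //; rewrite /letter; case: odd; [left|right].
  by rewrite [altword _]/= !word_eval_cons es.
have := @uared (s ++ altword m.-1); rewrite reduced_altword es !word_eval_cat.
rewrite (altword_end m2 cm) size_cat size_altword => h.
have : (size u <= size s + m.-1)%N; last by lia.
apply: h; first by apply/word_cat; split=> //; exact: altword_word.
by apply: funext => v /=; rewrite reflK.
Qed.

Lemma reduced_eval_ge0 : exists p q : R,
  [/\ 0 <= p, 0 <= q & ev u a = p *: a + q *: b].
Proof.
have [p0 p1] : 0 <= cheb c (size u) /\ 0 <= cheb c (size u).+1.
  case: ab_cos => [[m m2 cm]|c1].
    have um := reduced_altword_small m2 cm; rewrite cm.
    by split; apply: cheb_cos_ge0 => //; exact: ltnW.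
  by split; [case/andP: (cheb_ge0 (size u) c1)|case/andP: (cheb_ge0 (size u).+1 c1)].
rewrite reduced_altword altword_eval.
by case: odd; [exists (cheb c (size u)), (cheb c (size u).+1)
  |exists (cheb c (size u).+1), (cheb c (size u))].
Qed.

End DihedralWords.

Section RootSigns.
Variables (R : realType) (V : lmodType R) (B : {symmetric V}) (Pi : set V).
Hypothesis hPi : simple_roots B Pi.

Local Notation rf := (refl B).
Local Notation ev := (word_eval B).
Local Notation W := (weyl B Pi).
Local Notation len := (len B Pi).
Local Notation cone := (nonneg_comb Pi).

Let norm1 a : Pi a -> B a a = 1. Proof. by case: hPi => _ h _; exact: h. Qed.

(** Let [b] be the last letter of a reduced word of [w], so that [b <> a]. Write
    [w = v u] with [u] a word in [a] and [b], lengths adding up, and [v] as short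
    as possible. Then [v] ascends along both [a] and [b], so by induction [v a]
    and [v b] are non-negative combinations; and [u a] is a non-negative
    combination of [a] and [b] because [u] is a short enough alternating word.
    Assuming only a weak inequality makes it unnecessary to know beforehand that
    lengths change parity. *)
Lemma cone_of_ascent w a : W w -> Pi a -> (len w <= len (w \o rf a))%N -> cone (w a).
Proof.
elim/ltn_ind: {w}(len w) {-2}w (erefl (len w)) a => n IH w wn a Ww Pa wa.
have [s] := reduced_word norm1 Ww; case/lastP: s => [|s b] [ws es ss].
  by rewrite es; exact: cone_simple.
have [wsb Pb] : word Pi s /\ Pi b.
  move: ws; rewrite -cats1 => /word_cat[? /word_cons[]] //.
have eb : w = ev s \o rf b by rewrite es -cats1 word_eval_cat.
rewrite size_rcons in ss.
have nab : a <> b.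
  move=> ab; move: wa; rewrite -ss eb -ab.
  have -> : (ev s \o rf a) \o rf a = ev s.
    by apply: funext => v /=; rewrite reflK // norm1.
  by move/(leq_trans)=> /(_ _ (len_word B wsb)); rewrite ltnn.
have sub_ab : [set a; b] `<=` Pi by move=> x [->|->].
have word_ab u : word [set a; b] u -> word Pi u by move=> h x /h /sub_ab.
have len_mul v u : W v -> word [set a; b] u -> (len (v \o ev u) <= len v + size u)%N.
  move=> Wv abu; have [t [wt -> <-]] := reduced_word norm1 Wv.
  rewrite -word_eval_cat -size_cat; apply: len_word.
  by apply/word_cat; split=> //; exact: word_ab.
(* The possible lengths of the left factor [v]; its least element is taken. *)
pose P k := `[< exists v u, [/\ W v, word [set a; b] u, w = v \o ev u,
  (len v + size u)%N = len w & len v = k] >].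
have exP : exists k, P k.
  exists (len (ev s)); apply/asboolP; exists (ev s), [:: b].
  have abb : word [set a; b] [:: b] by apply/word_cons; split=> //; right.
  split=> //; first exact: weyl_word.
  have := len_mul _ _ (weyl_word norm1 wsb) abb; rewrite -[ev s \o _]eb -ss /=.
  by have := len_word B wsb; lia.
case: (ex_minnP exP) => k /asboolP[v [u [Wv abu ew luw lv]]] kmin.
have kn : (k < n)%N.
  have : (k <= len (ev s))%N.
    apply: kmin; apply/asboolP; exists (ev s), [:: b].
    have abb : word [set a; b] [:: b] by apply/word_cons; split=> //; right.
    split=> //; first exact: weyl_word.
    have := len_mul _ _ (weyl_word norm1 wsb) abb; rewrite -[ev s \o _]eb -ss /=.
    by have := len_word B wsb; lia.
  by have := len_word B wsb; lia.
have asc d : [set a; b] d -> (len v <= len (v \o rf d))%N.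
  move=> abd; rewrite leqNgt; apply/negP => vd.
  have Wvd : W (v \o rf d).
    by apply: weyl_comp => //; apply: weyl_simple => //; exact: sub_ab.
  have abdu : word [set a; b] (d :: u) by apply/word_cons.
  have e : w = (v \o rf d) \o ev (d :: u).
    rewrite ew; apply: funext => z; rewrite word_eval_cons /= reflK //.
    by apply: norm1; exact: sub_ab.
  have := len_mul _ _ Wvd abdu; rewrite -e /= => h.
  have : (k <= len (v \o rf d))%N; last by lia.
  apply: kmin; apply/asboolP; exists (v \o rf d), (d :: u); split=> //=.
  by lia.
have [ca cb] : cone (v a) /\ cone (v b).
  by split; apply: (IH k) => //; apply: asc; [left|right].
have [|||p [q [p0 q0 e]]] := @reduced_eval_ge0 _ _ B a b (norm1 Pa) (norm1 Pb) u abu.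
- move=> u' abu' e; have := len_mul _ _ Wv abu'; rewrite e -ew; lia.
- move=> u' abu' e; have := len_mul _ _ Wv abu'; rewrite e.
  by rewrite -[v \o (_ \o _)]/((v \o ev u) \o rf a) -ew; lia.
- case: hPi => _ _ /(_ a b Pa Pb nab)[[m m2 ->]|h]; last by right; lra.
  by left; exists m; rewrite ?opprK.
rewrite ew /= e (weylD norm1 _ _ Wv) !(weylZ norm1 _ _ Wv).
by apply: coneD; exact: coneZ.
Qed.

(** Either [w] ascends along [a], or [w] composed with the reflection in [a]
    does, and the latter maps [a] to [- w a]. *)
Lemma cone_or_opp v : root_system B Pi v -> cone v \/ cone (- v).
Proof.
case=> w [a [Ww Pa ->]].
case: (leqP (len w) (len (w \o rf a))) => [h|/ltnW h].
  by left; exact: cone_of_ascent.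
right; rewrite -(weylN norm1 _ Ww) -(refl_self (norm1 Pa)).
apply: (@cone_of_ascent (w \o rf a)) => //.
  by apply: weyl_comp => //; exact: weyl_simple.
have -> // : (w \o rf a) \o rf a = w.
by apply: funext => z /=; rewrite reflK // norm1.
Qed.

End RootSigns.

(** * Root bases *)
Section RootBases.
Variables (R : realType) (V : lmodType R) (B : {symmetric V}).

(** The properties of simple roots from which the theory of length follows. No
    condition on the angles is imposed beyond a sign, because these properties
    are also wanted for the canonical generators of the root system of a plane,
    whose angles are not known. *)
Definition root_basis (Pi : set V) :=
  [/\ forall v, nonneg_comb Pi v -> nonneg_comb Pi (- v) -> v = 0,
      forall a, Pi a -> B a a = 1,
      forall a b, Pi a -> Pi b -> a <> b -> B a b <= 0
    & forall v, root_system B Pi v -> nonneg_comb Pi v \/ nonneg_comb Pi (- v)].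

Lemma simple_roots_basis Pi : simple_roots B Pi -> root_basis Pi.
Proof.
move=> hPi; case: (hPi) => indep norm1 angles; split=> //.
- exact: cone_pointed.
- move=> a b Pa Pb /angles[]// => [[m m2 ->]|h]; last by lra.
  have [h0 h1] := pi_div_nat R m2; rewrite oppr_le0; apply: cos_ge0_pihalf.
  by rewrite h1 andbT; apply: le_trans (ltW h0); have := pi_gt0 R; lra.
- exact: cone_or_opp.
Qed.

Variable Pi : set V.
Hypothesis hPi : root_basis Pi.
Implicit Types (a b u v w : V) (k p q : R) (x y : V -> V).

Local Notation rf := (refl B).
Local Notation ev := (word_eval B).
Local Notation W := (weyl B Pi).
Local Notation len := (len B Pi).
Local Notation cone := (nonneg_comb Pi).
Local Notation root := (root_system B Pi).
Local Notation pos := (pos_roots B Pi).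

Lemma basis_norm a : Pi a -> B a a = 1. Proof. by case: hPi => _ h _ _; exact: h. Qed.
Let norm1 := basis_norm.

Lemma basis_pointed v : cone v -> cone (- v) -> v = 0.
Proof. by case: hPi => h _ _ _; exact: h. Qed.

Lemma pos_norm v : pos v -> B v v = 1.
Proof. by move=> [/(root_norm norm1)]. Qed.

Lemma pos_simple a : Pi a -> pos a.
Proof. by move=> Pa; split; [exact: simple_root|exact: cone_simple]. Qed.

Lemma root_sign v : root v -> pos v \/ pos (- v).
Proof.
move=> rv; case: hPi => _ _ _ /(_ v rv)[]; [by left|right; split=> //].
exact: root_opp.
Qed.

Lemma pos_opp v : pos v -> ~ pos (- v).
Proof.
move=> pv [_ cv]; have v0 := basis_pointed pv.2 cv.
have := pos_norm pv; rewrite v0 -(scale0r v) bformZl mul0r => /esym/eqP.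
by rewrite oner_eq0.
Qed.

Lemma pos_comb u v p q : 0 <= p -> 0 <= q -> pos u -> pos v -> cone (p *: u + q *: v).
Proof. by move=> p0 q0 [_ cu] [_ cv]; apply: coneD; exact: coneZ. Qed.

(** Separating the coefficient of [a]; the rest has non-positive product with
    [a] because distinct simple roots do. *)
Lemma cone_split a v : Pi a -> cone v ->
  exists k v', [/\ 0 <= k, cone v', v = k *: a + v' & B v' a <= 0].
Proof.
move=> Pa; move: v; apply: cone_ind => [|b k v Pb k0 [k' [v' [k'0 cv' -> v'a]]]].
  exists 0, 0; split=> //; [exact: cone0|by rewrite scale0r addr0|].
  by rewrite -(scale0r a) bformZl mul0r.
case: (pselect (b = a)) => [->|ba].
  by exists (k + k'), v'; split=> //; [exact: addr_ge0|vec [:: a; v']].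
exists k', (k *: b + v'); split=> //; last first.
- have := mulr_ge0 k0 (_ : 0 <= - B b a); rewrite !bformE oppr_ge0.
  by case: hPi => _ _ /(_ b a Pb Pa ba) h _ /(_ h); lra.
- by vec [:: a; b; v'].
by apply: coneD => //; apply: coneZ => //; exact: cone_simple.
Qed.

(** A simple root spans an extremal ray of the cone. Simple roots may be linearly
    dependent, so coefficients cannot be compared; instead, after the multiples of
    [a] are split off, the remainders add up to a multiple of [a] whose factor is
    at most [0] by pairing with [a], and pointedness kills them. *)
Lemma simple_extremal a v w k : Pi a -> cone v -> cone w -> v + w = k *: a ->
  exists2 c, 0 <= c & v = c *: a.
Proof.
move=> Pa cv cw; have [k1 [v' [k10 cv' -> v'a]]] := cone_split Pa cv.
have [k2 [w' [k20 cw' -> w'a]]] := cone_split Pa cw => e.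
have {}e : v' + w' = (k - k1 - k2) *: a.
  have -> : v' + w' = (k1 *: a + v' + (k2 *: a + w')) - k1 *: a - k2 *: a.
    by vec [:: v'; w'; a].
  by rewrite e; vec [:: a].
have d0 : k - k1 - k2 <= 0.
  have : B (v' + w') a = k - k1 - k2 by rewrite e bformZl norm1 // mulr1.
  by rewrite bformDl; lra.
exists k1 => //; suff -> : v' = 0 by rewrite addr0.
apply: basis_pointed => //; have -> : - v' = w' + (- (k - k1 - k2)) *: a.
  by rewrite scaleNr -e; vec [:: v'; w'].
by apply: coneD => //; apply: coneZ; [lra|exact: cone_simple].
Qed.

Lemma pos_scale v w k : pos v -> pos w -> v = k *: w -> v = w.
Proof.
move=> pv pw e; have := pos_norm pv; rewrite e bformZl bformZr (pos_norm pw).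
rewrite mulr1 -expr2 => /eqP; rewrite sqrf_eq1 => /orP[]/eqP k1.
  by rewrite k1 scale1r.
by case: (pos_opp pw); rewrite -scaleN1r -k1 -e.
Qed.

Lemma pos_extremal a v w k : Pi a -> pos v -> cone w -> v + w = k *: a -> v = a.
Proof.
move=> Pa pv cw /(simple_extremal Pa pv.2 cw)[c _].
by apply: pos_scale => //; exact: pos_simple.
Qed.

Lemma simple_indecomposable a u v p q : Pi a -> pos u -> pos v -> 0 <= p -> 0 <= q ->
  a = p *: u + q *: v -> u = a \/ v = a.
Proof.
move=> Pa pu pv p0 q0 e; case: (eqVneq p 0) => [p00|pn]; last first.
  left; apply: (@pos_extremal a u (p^-1 *: (q *: v)) p^-1) => //.
    by apply: coneZ; [rewrite invr_ge0|apply: coneZ => //; case: pv].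
  by rewrite e scalerDr !scalerA mulVf // scale1r.
right; apply/esym; apply: (@pos_scale _ _ q) => //; first exact: pos_simple.
by rewrite e p00 scale0r add0r.
Qed.

(** If the image were negative, [v] and its opposite would add up to a multiple
    of [a], which is extremal. *)
Lemma refl_simple_pos a v : Pi a -> pos v -> v <> a -> pos (rf a v).
Proof.
move=> Pa pv va; have rv : root (rf a v).
  by apply: refl_root => //; [exact: simple_root|case: pv].
case: (root_sign rv) => // - [_ c]; case: va.
apply: (pos_extremal Pa pv c (k := 2 * B v a)).
by rewrite /refl; vec [:: v; a].
Qed.

Lemma pos_refl_inj u v : pos u -> pos v -> rf u = rf v -> u = v.
Proof.
move=> pu pv e; have : rf v u = - u by rewrite -e refl_self // pos_norm.
rewrite /refl => h.
apply: (pos_scale pu pv (k := B u v)).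
have u2 : u = 2^-1 *: (u - - u) by vec [:: u]; field.
by rewrite [LHS]u2 -h; vec [:: u; v]; field.
Qed.

Lemma inversionsP x v : W x -> inversions B Pi x v <-> pos v /\ pos (- winv x v).
Proof.
move=> Wx; split=> [[pv [_ [w pw <-] e]]|[pv pw]]; split=> //.
  by rewrite -e (weylK norm1) ?opprK.
by exists (winv x v); [exists (- winv x v); rewrite ?opprK|rewrite (weylVK norm1)].
Qed.

Lemma winv_root x v : W x -> pos v -> root (winv x v).
Proof. by move=> Wx [rv _]; apply: weyl_root => //; exact: weyl_inv. Qed.

Lemma noninversionsP x v : W x -> noninversions B Pi x v <-> pos v /\ pos (winv x v).
Proof.
move=> Wx; split=> [[pv nv]|[pv pw]]; split=> //.
  case: (root_sign (winv_root Wx pv)) => // h; case: nv; exact/inversionsP.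
by move/(inversionsP _ Wx) => [_]; exact: pos_opp.
Qed.

(** Follow [v] through the letters of the word: a positive root becomes negative
    only when it meets the simple root of the current letter, and deleting that
    letter then amounts to multiplying by the reflection in [v]. *)
Lemma deletion s v : word Pi s -> pos v -> pos (- winv (ev s) v) ->
  exists s', [/\ word Pi s', (size s').+1 = size s & ev s' = rf v \o ev s].
Proof.
elim: s v => [|a s IH] v ws pv.
  have -> : winv (ev [::]) = id by apply: winvE.
  by move/pos_opp; rewrite opprK.
move: ws => /word_cons[Pa ws]; have Ws := weyl_word norm1 ws.
have ra := simple_root norm1 Pa.
rewrite word_eval_cons (winv_refl_comp norm1 _ ra Ws).
case: (pselect (v = a)) => [->|va].
  by exists s; rewrite (refl_cancel norm1 _ ra).
move=> /(IH _ ws (refl_simple_pos Pa pv va))[s' [ws' ss' es']].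
exists (a :: s'); rewrite /= ss'; split=> //; first exact/word_cons.
rewrite word_eval_cons es'; apply: funext => z /=.
by rewrite -(refl_refl norm1 _ _ ra) (reflK (norm1 Pa)).
Qed.

Lemma len_refl_lt x v : W x -> pos v -> pos (- winv x v) ->
  (len (rf v \o x) < len x)%N.
Proof.
move=> /(reduced_word norm1)[s [ws -> <-]] pv /(deletion ws pv)[s' [ws' <- <-]].
by rewrite ltnS; exact: len_word.
Qed.

Lemma len_refl_gt x v : W x -> pos v -> pos (winv x v) ->
  (len x < len (rf v \o x))%N.
Proof.
move=> Wx pv h; have Wr := weyl_refl norm1 pv.1.
have := @len_refl_lt (rf v \o x) v (weyl_comp norm1 Wr Wx) pv.
rewrite (refl_cancel norm1 _ pv.1); apply.
rewrite (winv_refl_comp norm1 _ pv.1 Wx) refl_self ?pos_norm //.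
by rewrite (weylN norm1 _ (weyl_inv norm1 Wx)) opprK.
Qed.

Lemma len_lt_refl x v : W x -> pos v -> (len (rf v \o x) < len x)%N ->
  pos (- winv x v).
Proof.
move=> Wx pv h; case: (root_sign (winv_root Wx pv)) => // /(len_refl_gt Wx pv).
by move/(ltn_trans h); rewrite ltnn.
Qed.

Lemma len_gt_refl x v : W x -> pos v -> (len x < len (rf v \o x))%N ->
  pos (winv x v).
Proof.
move=> Wx pv h; case: (root_sign (winv_root Wx pv)) => // /(len_refl_lt Wx pv).
by move/(ltn_trans h); rewrite ltnn.
Qed.

Lemma len_descent x a : W x -> Pi a -> pos (- winv x a) ->
  len x = (len (rf a \o x)).+1.
Proof.
move=> Wx Pa /(len_refl_lt Wx (pos_simple Pa)) h; apply/eqP.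
rewrite eqn_leq h andbT -{1}(refl_cancel norm1 x (simple_root norm1 Pa)).
apply: len_simplel => //; apply: weyl_comp => //; exact: weyl_simple.
Qed.

Lemma exists_descent x : W x -> (0 < len x)%N -> exists2 a, Pi a & pos (- winv x a).
Proof.
move=> Wx; case: (reduced_word norm1 Wx) => -[|a s] [ws e ss] l0.
  by rewrite -ss in l0.
move: (ws) => /word_cons[Pa ws']; exists a => //.
apply: len_lt_refl => //; first exact: pos_simple.
rewrite -ss e word_eval_cons (refl_cancel norm1) /= ?ltnS; first exact: len_word.
exact: simple_root.
Qed.

End RootBases.

(** * Decomposing an inversion across a length gap *)
Section Decomposition.
Variables (R : realType) (V : lmodType R) (B : {symmetric V}) (Pi : set V).
Hypothesis hPi : root_basis B Pi.
Implicit Types (a b u v w : V) (k p q : R) (x y : V -> V).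

Local Notation rf := (refl B).
Local Notation W := (weyl B Pi).
Local Notation len := (len B Pi).
Local Notation cone := (nonneg_comb Pi).
Local Notation root := (root_system B Pi).
Local Notation pos := (pos_roots B Pi).
Let norm1 := basis_norm hPi.

(** One step of closure reaches [v] from two other elements of [A]. *)
Definition between (A : set V) v := exists u w p q,
  [/\ A u, A w, u <> v & w <> v] /\ [/\ 0 <= p, 0 <= q & v = p *: u + q *: w].

Lemma pos_not_opp_cone v : pos v -> ~ cone (- v).
Proof. by move=> pv cv; apply: (pos_opp hPi pv); split=> //; apply: root_opp pv.1. Qed.

Lemma refl_neq u v w : root u -> v <> w -> rf u v <> rf u w.
Proof. by move=> ru vw /(can_inj (reflK (root_norm norm1 ru))). Qed.

(** Induction on the length of [x], removing a left descent [a]. If the length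
    gap survives for [rf a \o x] and the root [rf a v], the decomposition found
    there is reflected back. Otherwise [a] is an ascent of [rf v \o x], which makes
    [- rf v a] an inversion of [x], and [v] is a positive multiple of the sum of
    [a] and [- rf v a]. *)
Lemma inversion_between x v : W x -> inversions B Pi x v ->
  ((len (rf v \o x)).+1 < len x)%N -> between (inversions B Pi x) v.
Proof.
elim/ltn_ind: {x}(len x) {-2}x (erefl (len x)) v => n IH x xn v Wx xv vx.
have [pv nv] := (inversionsP hPi _ Wx).1 xv.
have [|a Pa na] := exists_descent hPi Wx; first by lia.
have ra := simple_root norm1 Pa; have pa := pos_simple hPi Pa.
have lx := len_descent hPi Wx Pa na; pose y := rf a \o x.
rewrite -/y in lx.
have Wy : W y by apply: weyl_comp => //; exact: weyl_simple.
have va : v <> a by move=> e; move: vx; rewrite e -/y lx; lia.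
have pv' := refl_simple_pos hPi Pa pv va.
have yE w : winv y (rf a w) = winv x w.
  by rewrite (winv_refl_comp norm1 _ ra Wx) (reflK (norm1 Pa)).
have e : rf (rf a v) \o y = rf a \o (rf v \o x).
  by apply: funext => z; rewrite /y /= (refl_refl norm1 _ _ ra).
case: (ltnP (len (rf (rf a v) \o y)).+1 (len y)) => h.
  have iv' : inversions B Pi y (rf a v) by apply/inversionsP; rewrite ?yE.
  have [|u [w [p [q [[iu iw uv wv] [p0 q0 ev]]]]]] := IH _ _ y erefl _ Wy iv' h.
    by rewrite -xn lx.
  have inv_refl z : inversions B Pi y z -> inversions B Pi x (rf a z).
    move=> /(inversionsP hPi _ Wy)[pz nz]; apply/(inversionsP hPi) => //.
    rewrite -yE (reflK (norm1 Pa)); split=> //; apply: refl_simple_pos => // za.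
    apply: (pos_opp hPi nz); rewrite opprK za -[a in winv _ a]opprK.
    by rewrite -(refl_self (norm1 Pa)) -reflN yE (weylN norm1 _ (weyl_inv norm1 Wx)).
  exists (rf a u), (rf a w), p, q; rewrite -(reflK (norm1 Pa) v).
  split; split=> //; try exact: inv_refl; try exact: refl_neq.
  by rewrite {1}ev reflD !reflZ.
pose t := rf v \o x; have Wt : W t by apply: weyl_comp => //; exact: (weyl_refl norm1 pv.1).
have pta : pos (winv t a).
  case: (root_sign hPi (winv_root hPi Wt pa)) => // /(len_descent hPi Wt Pa).
  by rewrite /t -e; lia.
have ta : winv t a = winv x (rf v a) by rewrite (winv_refl_comp norm1 _ pv.1 Wx).
have Wx' := weyl_inv norm1 Wx.
have B0 : 0 < B a v.
  rewrite ltNge; apply/negP => B0; apply: (pos_not_opp_cone pta).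
  have -> : - winv t a = 1 *: - winv x a + (- (2 * B a v)) *: - winv x v.
    rewrite ta /refl (weylD norm1 _ _ Wx') (weylN norm1 _ Wx') (weylZ norm1 _ _ Wx').
    by vec [:: winv x a; winv x v].
  by apply: (pos_comb _ _ na nv) => //; lra.
have B2 : B a v != 0 by exact: lt0r_neq0.
pose w := - rf v a.
have pw : pos w.
  have rw : root (rf v a) by apply: refl_root => //; case: pv.
  case: (root_sign hPi rw) => // pva; case: va.
  apply: (pos_extremal hPi Pa pv (w := (2 * B a v)^-1 *: rf v a) _ (k := (2 * B a v)^-1)).
    by apply: coneZ; [rewrite invr_ge0; lra|case: pva].
  by rewrite /refl; vec [:: a; v]; field.
have i0 : 0 <= (2 * B a v)^-1 by rewrite invr_ge0; lra.
exists a, w, (2 * B a v)^-1, (2 * B a v)^-1; split; split=> //.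
- exact/inversionsP.
- apply/(inversionsP hPi) => //; split=> //.
  by rewrite (weylN norm1 _ Wx') opprK -ta.
- by move=> av; apply: va.
- move=> wv; apply: va; apply: (can_inj (reflK (root_norm norm1 pv.1))).
  by rewrite refl_self ?(pos_norm hPi) // -{1}wv opprK.
by rewrite /w /refl; vec [:: a; v]; field.
Qed.

End Decomposition.

(** * The roots in a plane *)
Lemma seq_argmin (R : realType) (T : eqType) (P : T -> Prop) (f : T -> R) (s : seq T) z :
  z \in s -> P z -> exists m, [/\ m \in s, P m & forall y, y \in s -> P y -> f m <= f y].
Proof.
elim: s z => // c s IH z; case: (pselect (exists2 y, y \in s & P y)) => [[y ys Py] _ _|no].
  have [m [ms Pm mmin]] := IH y ys Py.
  case: (pselect (P c /\ f c <= f m)) => [[Pc cm]|ncm].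
    exists c; rewrite inE eqxx; split=> // t; rewrite inE => /predU1P[->//|ts Pt].
    exact: le_trans cm (mmin _ ts Pt).
  exists m; rewrite inE ms orbT; split=> // t; rewrite inE => /predU1P[->|]; last exact: mmin.
  by move=> Pc; rewrite leNgt; apply/negP => /ltW cm; apply: ncm.
rewrite inE => /predU1P[->|zs] Pz; last by case: no; exists z.
exists c; rewrite inE eqxx; split=> // t; rewrite inE => /predU1P[->//|ts Pt].
by case: no; exists t.
Qed.

Section PlaneEdges.
Variables (R : realType) (V : lmodType R) (B : {symmetric V}) (Pi : set V).
Hypothesis hPi : root_basis B Pi.
Implicit Types (a b d e g u v w : V) (k p q : R) (x y : V -> V).

Local Notation rf := (refl B).
Local Notation W := (weyl B Pi).
Local Notation cone := (nonneg_comb Pi).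
Local Notation root := (root_system B Pi).
Local Notation pos := (pos_roots B Pi).
Let norm1 := basis_norm hPi.

(** This finiteness is what provides extreme rays in a plane that may contain
    infinitely many roots. *)
Lemma inversions_finite x : W x -> exists s : seq V, forall v, inversions B Pi x v -> v \in s.
Proof.
case/(weylP norm1) => s ws ->; elim: s ws => [_|a s IH /word_cons[Pa ws]].
  exists [::] => v /(inversionsP hPi _ (weyl_id norm1))[pv].
  have -> : winv (word_eval B [::]) = id by apply: winvE.
  by move/(pos_opp hPi pv).
have [t st] := IH ws; exists (a :: map (rf a) t) => v.
have Ws := weyl_word norm1 ws.
have Was := weyl_word norm1 ((word_cons _ _ _).2 (conj Pa ws)).
move=> /(inversionsP hPi _ Was)[pv]; rewrite word_eval_cons.
rewrite (winv_refl_comp norm1 _ (simple_root norm1 Pa) Ws) => nv.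
rewrite inE; case: eqVneq => //= /eqP va; apply/mapP; exists (rf a v).
  by apply: st; apply/(inversionsP hPi) => //; split=> //; exact: refl_simple_pos.
by rewrite reflK // norm1.
Qed.

Lemma cone_opp_scale v k : pos v -> 0 < k -> ~ cone (- (k *: v)).
Proof.
move=> pv k0 cv; apply: (pos_not_opp_cone hPi pv).
have -> : - v = k^-1 *: - (k *: v) by vec [:: v]; field; exact: lt0r_neq0.
by apply: coneZ => //; rewrite invr_ge0 ltW.
Qed.

Definition lin_indep u v := forall p q, p *: u + q *: v = 0 -> p = 0 /\ q = 0.

Lemma pos_indep u v : pos u -> pos v -> u <> v -> lin_indep u v.
Proof.
move=> pu pv uv p q e; suff p0 : p = 0.
  split=> //; move: e; rewrite p0 scale0r add0r => e.
  have : B (q *: v) v = 0 by rewrite e -(scale0r v) bformZl mul0r.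
  by rewrite bformZl (pos_norm hPi pv) mulr1.
apply/eqP; case: (eqVneq p 0) => // pn; case: uv.
apply: (pos_scale hPi pu pv (k := - (q / p))).
have -> : u = p^-1 *: (p *: u + q *: v) - (q / p) *: v by vec [:: u; v]; field.
by rewrite e; vec [:: v].
Qed.

Lemma lin_indep_eq u v p q p' q' : lin_indep u v ->
  p *: u + q *: v = p' *: u + q' *: v -> p = p' /\ q = q'.
Proof.
move=> uv e; have [|h1 h2] := uv (p - p') (q - q'); last by split; lra.
have -> : (p - p') *: u + (q - q') *: v =
    (p *: u + q *: v) - (p' *: u + q' *: v) by vec [:: u; v].
by rewrite e subrr.
Qed.

Definition coordl u v w : R := xget 0 [set p | exists q, w = p *: u + q *: v].

Lemma coordlE u v p q : lin_indep u v -> coordl u v (p *: u + q *: v) = p.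
Proof.
move=> uv; rewrite /coordl; case: xgetP => [t _ [q' /(lin_indep_eq uv)[->]]//|].
by move/(_ p); case; exists q.
Qed.

Definition plane u v : set V := [set w | exists p q, w = p *: u + q *: v].

Lemma planel u v : plane u v u. Proof. by exists 1, 0; vec [:: u; v]. Qed.

Lemma planer u v : plane u v v. Proof. by exists 0, 1; vec [:: u; v]. Qed.

Lemma plane_comb u v w z p q : plane u v w -> plane u v z -> plane u v (p *: w + q *: z).
Proof.
move=> [p1 [q1 ->]] [p2 [q2 ->]]; exists (p * p1 + q * p2), (p * q1 + q * q2).
by vec [:: u; v].
Qed.

Lemma plane_sub u v u' v' : plane u v u' -> plane u v v' -> plane u' v' `<=` plane u v.
Proof. by move=> hu hv w [p [q ->]]; apply: plane_comb. Qed.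

Lemma form_inverted_gt0 u v : pos u -> pos v -> pos (- rf u v) -> 0 < B v u.
Proof.
move=> pu pv nv; rewrite ltNge; apply/negP => B0; apply: (pos_not_opp_cone hPi nv).
rewrite opprK /refl -scaleNr -[v]scale1r.
by apply: (pos_comb _ _ pv pu) => //; rewrite scale1r; lra.
Qed.

(** The assumption says that on one side of [a] there are only inversions of the
    reflection in [a], hence finitely many roots, so there is an extreme one. The
    slope to maximize is the coefficient along [b] over the product with [a],
    which is positive on these inversions. In the conclusion, [p * q' - p' * q]
    is the determinant of [d] and [v]: all positive roots of the plane lie on the
    same side of [d]. *)
Lemma one_sided_edge a b : pos a -> lin_indep b a ->
  (forall v p q, pos v -> v = p *: b + q *: a -> 0 < p -> pos (- rf a v)) ->
  exists d p q, [/\ pos d, d = p *: b + q *: a &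
    forall v p' q', pos v -> v = p' *: b + q' *: a -> 0 <= p * q' - p' * q].
Proof.
move=> pa ind side; have Wa := weyl_refl norm1 pa.1.
have [s sP] := inversions_finite Wa.
pose S v := [/\ pos v, pos (- rf a v) & exists p q, 0 <= p /\ v = p *: b + q *: a].
have Ss v : S v -> v \in s.
  move=> [pv nv _]; apply: sP; apply/(inversionsP hPi) => //; split=> //.
  by rewrite winv_refl // (pos_norm hPi).
have Sa : S a.
  split=> //; first by rewrite refl_self ?opprK // (pos_norm hPi).
  by exists 0, 1; split=> //; vec [:: a; b].
have Bpos v : S v -> 0 < B v a by move=> [pv nv _]; exact: form_inverted_gt0.
have [d [ds Sd dmin]] := seq_argmin (fun v => - (coordl b a v / B v a)) (Ss a Sa) Sa.
have [pd _ [p [q [p0 ed]]]] := Sd.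
exists d, p, q; split=> // v p' q' pv ev.
case: (ltrP p' 0) => p'0.
  rewrite leNgt; apply/negP => D0.
  apply: (cone_opp_scale pa (k := - (p * q' - p' * q))); first by lra.
  have -> : - (- (p * q' - p' * q) *: a) = p *: v + (- p') *: d.
    by rewrite ed ev; vec [:: a; b].
  by apply: (pos_comb _ _ pv pd) => //; lra.
have Sv : S v.
  move: p'0; rewrite le_eqVlt => /predU1P[p'0|p'0].
    suff -> : v = a by [].
    by apply: (pos_scale hPi pv pa (k := q')); rewrite ev -p'0 scale0r add0r.
  by split=> //; [exact: side ev p'0|exists p', q'; split=> //; exact: ltW].
have := dmin v (Ss v Sv) Sv; rewrite lerN2 {1}ev {1}ed !coordlE //.
have Bv := Bpos v Sv; have Bd := Bpos d Sd.
rewrite ler_pdivrMr // mulrAC ler_pdivlMr //.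
have -> : B d a = p * B b a + q by rewrite ed !bformE (pos_norm hPi pa) mulr1.
have -> : B v a = p' * B b a + q' by rewrite ev !bformE (pos_norm hPi pa) mulr1.
lra.
Qed.

(** One of the two sides of [a] satisfies the assumption of the previous lemma:
    otherwise there are positive roots on both sides which the reflection in [a]
    keeps positive, and [a] is a non-negative combination of them although that
    reflection negates it. *)
Lemma plane_edge a b : pos a -> pos b -> a <> b -> exists d e,
  [/\ pos d, pos e, d <> e, plane d e a & plane d e b] /\
  forall v p q, pos v -> v = p *: d + q *: e -> 0 <= q.
Proof.
move=> pa pb ab.
have [b' [bb' b'b ind [d [p [q [pd ed hd]]]]]] : exists b', [/\ plane b' a b, plane a b b',
   lin_indep b' a &
   exists d p q, [/\ pos d, d = p *: b' + q *: a & forall v p' q', pos v ->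
     v = p' *: b' + q' *: a -> 0 <= p * q' - p' * q]].
  have ba : b <> a by move=> e; apply: ab.
  have ind := pos_indep pb pa ba.
  have indN : lin_indep (- b) a.
    move=> p q e; have [|h1 h2] := ind (- p) q; last by split; lra.
    by rewrite -e; vec [:: a; b].
  case: (pselect (forall v p q, pos v -> v = p *: b + q *: a -> 0 < p ->
      pos (- rf a v))) => [side|nside].
    by exists b; split=> //; [exact: planel|exact: planer|exact: one_sided_edge].
  exists (- b); split=> //.
  - by exists (- 1), 0; vec [:: a; b].
  - by exists 0, (- 1); vec [:: a; b].
  apply: one_sided_edge => // v p q pv ev p0; apply: contrapT => nv; apply: nside.
  move=> w p' q' pw ew p'0; apply: contrapT => nw.
  have sgn z : pos z -> ~ pos (- rf a z) -> pos (rf a z).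
    by move=> pz; case: (root_sign hPi (refl_root norm1 pa.1 pz.1)).
  have {}nv := sgn _ pv nv; have {}nw := sgn _ pw nw.
  have e : p *: w + p' *: v = (p * q' + p' * q) *: a.
    by rewrite ev ew; vec [:: a; b].
  have c1 : cone (p *: w + p' *: v) by apply: (pos_comb _ _ pw pv); exact: ltW.
  have c2 : cone (- (p *: w + p' *: v)).
    rewrite {1}e -scalerN -(refl_self (pos_norm hPi pa)) -reflZ -e reflD !reflZ.
    by apply: (pos_comb _ _ nw nv); exact: ltW.
  have z0 := basis_pointed hPi c1 c2.
  apply: (cone_opp_scale pv p'0).
  have -> : - (p' *: v) = p *: w - (p *: w + p' *: v) by vec [:: v; w].
  by rewrite z0 subr0; apply: coneZ (ltW p0) pw.2.
have [e [pe de eab]] : exists e, [/\ pos e, d <> e & d = a /\ e = b \/ d <> a /\ e = a].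
  case: (pselect (d = a)) => da; first by exists b; split=> //; [rewrite da|left].
  by exists a; split=> //; right.
have [pea peb] : plane d e a /\ plane d e b.
  case: eab => [[da eb]|[da ea]].
    by rewrite -{1}da -eb; split; [exact: planel|exact: planer].
  rewrite ea; split; first exact: planer.
  have p0 : p != 0.
    apply/eqP => p0; apply: da; apply: (pos_scale hPi pd pa (k := q)).
    by rewrite ed p0 scale0r add0r.
  apply: plane_sub bb'; last exact: planer.
  by exists p^-1, (- (q / p)); rewrite ed; vec [:: a; b']; field.
exists d, e; split=> // v s t pv ev.
have [p1 [q1 ee]] : plane b' a e.
  by case: eab => [[_ ->//]|[_ ->]]; exact: planer.
have De := hd e p1 q1 pe ee.
have De0 : p * q1 - p1 * q != 0.
  apply/eqP => D0; have indde := pos_indep pd pe de.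
  have [|p10 p0] := indde (- p1) p.
    transitivity ((p * q1 - p1 * q) *: a); first by rewrite ed ee; vec [:: a; b'].
    by rewrite D0 scale0r.
  have [|q10 q0] := indde (- q1) q.
    transitivity (- (p * q1 - p1 * q) *: b'); first by rewrite ed ee; vec [:: a; b'].
    by rewrite D0 oppr0 scale0r.
  have := pos_norm hPi pd; rewrite ed p0 q0 !scale0r addr0 -(scale0r a) bformZl mul0r.
  by move/esym/eqP; rewrite oner_eq0.
have := hd v (s * p + t * p1) (s * q + t * q1) pv.
have -> : p * (s * q + t * q1) - (s * p + t * p1) * q = t * (p * q1 - p1 * q) by ring.
rewrite pmulr_lge0; first by apply; rewrite ev ed ee; vec [:: a; b'].
by rewrite lt_def De0.
Qed.

(** The inversion of the reflection in [b] which is farthest from [d] bounds the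
    positive roots on the other side: a positive root [v] beyond it would, like [d], be
    kept positive by the reflection in [b], while [b] lies between [d] and [v]. *)
Lemma second_edge d b : pos d -> pos b -> d <> b -> pos (rf b d) ->
  (forall v p q, pos v -> v = p *: d + q *: b -> 0 <= q) ->
  exists g, [/\ pos g, d <> g, plane d g b, plane d b g &
    forall v, pos v -> plane d b v -> exists s t : R, [/\ 0 <= s, 0 <= t & v = s *: d + t *: g]].
Proof.
move=> pd pb db rbd edge; have ind := pos_indep pd pb db.
have [s sP] := inversions_finite (weyl_refl norm1 pb.1).
pose S v := [/\ pos v, pos (- rf b v) & exists p q, 0 < q /\ v = p *: d + q *: b].
have Ss v : S v -> v \in s.
  move=> [pv nv _]; apply: sP; apply/(inversionsP hPi); first exact: weyl_refl pb.1.
  by split=> //; rewrite winv_refl // (pos_norm hPi).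
have Sb : S b.
  split=> //; first by rewrite refl_self ?opprK // (pos_norm hPi).
  by exists 0, 1; split=> //; vec [:: d; b].
have bd_ind : lin_indep b d by apply: pos_indep => // /esym.
pose f v := coordl d b v / coordl b d v.
have fE p q : f (p *: d + q *: b) = p / q.
  by rewrite /f coordlE // [p *: d + _]addrC coordlE.
have [g [gs Sg gmin]] := seq_argmin f (Ss b Sb) Sb.
have [pg _ [p [q [q0 eg]]]] := Sg.
have qn : q != 0 by exact: lt0r_neq0.
have p0 : p <= 0.
  have := gmin b (Ss b Sb) Sb; rewrite eg fE.
  have -> : f b = 0 / 1 by rewrite -(fE 0 1); congr f; vec [:: d; b].
  by rewrite mul0r pmulr_lle0 // invr_gt0.
exists g; split=> //.
- move=> dg; have [] := lin_indep_eq ind (_ : 1 *: d + 0 *: b = p *: d + q *: b).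
    by rewrite -eg -dg; vec [:: d; b].
  by move=> _ q00; rewrite -q00 ltxx in q0.
- by exists (- (p / q)), q^-1; rewrite eg; vec [:: d; b]; field.
- by exists p, q.
move=> v pv [p' [q' ev]]; have q'0 := edge v p' q' pv ev.
exists ((p' * q - q' * p) / q), (q' / q); split.
- rewrite divr_ge0 ?(ltW q0) // subr_ge0 leNgt; apply/negP => h.
  have p'0 : p' < 0.
    rewrite -(pmulr_llt0 _ q0); apply: lt_le_trans h _.
    by rewrite mulr_ge0_le0.
  move: q'0; rewrite le_eqVlt => /predU1P[q'0|q'0].
    apply: (cone_opp_scale pd (k := - p')); first by lra.
    have -> : - (- p' *: d) = v by rewrite ev -q'0; vec [:: d; b].
    by case: pv.
  case: (root_sign hPi (refl_root norm1 pb.1 pv.1)) => rbv.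
    apply: (cone_opp_scale pb q'0).
    have -> : - (q' *: b) = 1 *: rf b v + (- p') *: rf b d.
      by rewrite ev reflD !reflZ (refl_self (pos_norm hPi pb)); vec [:: rf b d; b].
    by apply: (pos_comb _ _ rbv rbd); lra.
  have Sv : S v by split=> //; exists p', q'.
  have := gmin v (Ss v Sv) Sv; rewrite eg ev !fE ler_pdivrMr // mulrAC ler_pdivlMr //.
  by rewrite leNgt [p * q']mulrC h.
- by rewrite divr_ge0 // ltW.
by rewrite ev eg; vec [:: d; b]; field.
Qed.

(** The positive roots of a plane are contained in the cone of two of them, the
    canonical simple roots of the plane. *)
Theorem plane_basis a b : pos a -> pos b -> a <> b -> exists d g,
  [/\ pos d, pos g, d <> g, plane d g a & plane d g b] /\
  forall v, pos v -> plane d g v -> exists s t : R, [/\ 0 <= s, 0 <= t & v = s *: d + t *: g].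
Proof.
move=> pa pb ab; have [d [e [[pd pe de ha hb] edge]]] := plane_edge pa pb ab.
have ind := pos_indep pd pe de.
have [b' [pb' db' rbd eb' edge']] : exists b', [/\ pos b', d <> b', pos (rf b' d),
    plane d b' e & forall v p q, pos v -> v = p *: d + q *: b' -> 0 <= q].
  case: (root_sign hPi (refl_root norm1 pe.1 pd.1)) => [rd|rd].
    by exists e; split=> //; exact: planer.
  (* If the reflection in [e] inverts [d], that in [rf d e] does not. *)
  have B0 : 0 < B e d by rewrite bformC; exact: form_inverted_gt0.
  have pr : pos (rf d e).
    case: (root_sign hPi (refl_root norm1 pd.1 pe.1)) => // h.
    have e0 : - rf d e = (2 * B e d) *: d + (- 1) *: e by rewrite /refl; vec [:: d; e].
    by have := edge _ _ _ h e0; rewrite oppr_ge0 ler10.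
  have edge' v p q : pos v -> v = p *: d + q *: rf d e -> 0 <= q.
    move=> pv ev; apply: (edge v (p - 2 * q * B e d) q pv).
    by rewrite ev /refl; vec [:: d; e].
  exists (rf d e); split=> //.
  - move=> dde; have [] := lin_indep_eq ind
      (_ : 1 *: d + 0 *: e = (- (2 * B e d)) *: d + 1 *: e).
      by rewrite [X in X + _]scale1r {1}dde /refl; vec [:: d; e].
    by move=> _ /esym/eqP; rewrite oner_eq0.
  - have -> : rf (rf d e) d = rf d (- rf e d).
      by rewrite -{2}[d](reflK (pos_norm hPi pd)) (refl_refl norm1 _ _ pd.1)
        (refl_self (pos_norm hPi pd)) reflN.
    case: (root_sign hPi (refl_root norm1 pd.1 rd.1)) => // h.
    have e0 : - rf d (- rf e d) =
        (1 - 2 * B (rf e d) d) *: d + (- (2 * B e d)) *: e.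
      by rewrite /refl !bformE (bformC B d e) (pos_norm hPi pd); vec [:: d; e].
    by have := edge _ _ _ h e0; rewrite oppr_ge0 leNgt mulr_gt0.
  by exists (2 * B e d), 1; rewrite /refl; vec [:: d; e].
have [g [pg dg gb' b'g gP]] := second_edge pd pb' db' rbd edge'.
have sub1 : plane d e `<=` plane d b' by apply: plane_sub => //; exact: planel.
have sub2 : plane d b' `<=` plane d g by apply: plane_sub => //; exact: planel.
exists d, g; split; first by split=> //; [exact/sub2/sub1|exact/sub2/sub1].
move=> v pv dgv; apply: gP => //; by apply: plane_sub dgv => //; exact: planel.
Qed.

End PlaneEdges.

(** * The reflection subgroup of a plane *)
Section Dihedral.
Variables (R : realType) (V : lmodType R) (B : {symmetric V}) (Pi : set V).
Hypothesis hPi : root_basis B Pi.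
Variable d : bool -> V.
Hypotheses (d_pos : forall i, pos_roots B Pi (d i)) (d_neq : d true <> d false)
  (d_span : forall v, pos_roots B Pi v -> plane (d true) (d false) v ->
     exists s t : R, [/\ 0 <= s, 0 <= t & v = s *: d true + t *: d false]).
Implicit Types (v w : V) (k p q : R) (u x y g h : V -> V) (i j e : bool).

Local Notation rf := (refl B).
Local Notation W := (weyl B Pi).
Local Notation len := (len B Pi).
Local Notation cone := (nonneg_comb Pi).
Local Notation root := (root_system B Pi).
Local Notation pos := (pos_roots B Pi).
Local Notation P := (plane (d true) (d false)).
Let norm1 := basis_norm hPi.

Definition pair_set : set V := range d.

Local Notation W2 := (weyl B pair_set).
Local Notation len2 := (Defs.len B pair_set).
Local Notation root2 := (root_system B pair_set).
Local Notation pos2 := (pos_roots B pair_set).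

Lemma pair_set_mem i : pair_set (d i). Proof. by exists i. Qed.

Lemma pair_norm v : pair_set v -> B v v = 1.
Proof. by case=> i _ <-; exact: (pos_norm hPi (d_pos i)). Qed.

Lemma pair_indep i : lin_indep (d i) (d (~~ i)).
Proof.
by apply: (pos_indep hPi) => //; case: i => //= /esym.
Qed.

Lemma plane_coord i v : P v -> exists p q, v = p *: d i + q *: d (~~ i).
Proof.
case: i => -[p [q ->]]; first by exists p, q.
by exists q, p; rewrite addrC.
Qed.

Lemma plane_mem i v p q : v = p *: d i + q *: d (~~ i) -> P v.
Proof.
move=> ->; case: i; first by exists p, q.
by exists q, p; rewrite addrC.
Qed.

Lemma plane_gen i : P (d i).
Proof. by apply: (@plane_mem i _ 1 0); vec [:: d i; d (~~ i)]. Qed.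

Lemma d_span_ge0 i v p q : pos v -> v = p *: d i + q *: d (~~ i) -> 0 <= p /\ 0 <= q.
Proof.
move=> pv ev; have [s [t [s0 t0 e]]] := d_span pv (plane_mem ev).
case: i ev => ev; last rewrite addrC in e.
  by have [-> ->] := lin_indep_eq (@pair_indep true) (etrans (esym ev) e).
by have [-> ->] := lin_indep_eq (@pair_indep false) (etrans (esym ev) e).
Qed.

Lemma plane_refl i v : P v -> P (rf (d i) v).
Proof.
move=> Pv; rewrite /refl -[v in v - _]scale1r -scaleNr.
by apply: plane_comb => //; exact: plane_gen.
Qed.

Lemma pair_cone v : pos v -> P v -> nonneg_comb pair_set v.
Proof.
move=> pv /(d_span pv)[s [t [s0 t0 ->]]].
by apply: coneD; apply: coneZ => //; apply: cone_simple; exact: pair_set_mem.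
Qed.

Lemma pair_cone_sub v : nonneg_comb pair_set v -> cone v.
Proof.
move: v; apply: cone_ind; first exact: cone0.
by move=> a k v [i _ <-] k0 cv; apply: coneD => //; apply: coneZ => //; case: (d_pos i).
Qed.

Lemma pair_weyl g : W2 g -> W g /\ forall v, P v -> P (g v).
Proof.
move=> /(weylP pair_norm)[s ws ->]; elim: s ws => [_|a s IH /word_cons[[i _ <-] ws]].
  by split=> //; exact: (weyl_id norm1).
have [Ws Ps] := IH ws; rewrite word_eval_cons; split; last first.
  by move=> v /Ps Pv /=; exact: plane_refl.
by apply: weyl_comp => //; apply: (weyl_refl norm1); case: (d_pos i).
Qed.

Lemma pair_root v : root2 v -> root v /\ P v.
Proof.
move=> [g [a [/pair_weyl[Wg Pg] [i _ <-] ->]]]; split; last exact/Pg/plane_gen.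
by apply: weyl_root => //; case: (d_pos i).
Qed.

(** The two canonical roots form a root basis: the sign condition is inherited
    from the ambient system, and a positive product would produce, by reflecting
    one of them in the other, a root of mixed signs. Thus lengths and inversions
    with respect to these two reflections obey the theory above. *)
Lemma pair_basis : root_basis B pair_set.
Proof.
split.
- by move=> v cv cnv; apply: (basis_pointed hPi); exact: pair_cone_sub.
- exact: pair_norm.
- move=> _ _ [i _ <-] [j _ <-] ij.
  have -> : j = ~~ i by case: i j ij => -[].
  rewrite leNgt; apply/negP => B0.
  have rr : root (rf (d i) (d (~~ i))).
    by apply: (refl_root norm1); [case: (d_pos i)|case: (d_pos (~~ i))].
  rewrite bformC in B0; case: (root_sign hPi rr) => h.
    have [] := @d_span_ge0 i _ (- (2 * B (d (~~ i)) (d i))) 1 h.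
      by rewrite /refl; vec [:: d i; d (~~ i)].
    by rewrite oppr_ge0 leNgt mulr_gt0.
  have [] := @d_span_ge0 i _ (2 * B (d (~~ i)) (d i)) (- 1) h.
    by rewrite /refl; vec [:: d i; d (~~ i)].
  by move=> _; rewrite oppr_ge0 ler10.
move=> v /pair_root[rv Pv]; case: (root_sign hPi rv) => h; [left|right].
  exact: pair_cone.
apply: pair_cone => //; have [p [q ->]] := Pv.
by exists (- p), (- q); vec [:: d true; d false].
Qed.

Let hPi2 := pair_basis.
Let norm2 := pair_norm.

Lemma pair_pos v : pos2 v -> pos v.
Proof. by move=> [/pair_root[rv _] cv]; split=> //; exact: pair_cone_sub. Qed.

Lemma plane_refl_pos i v : pos v -> P v -> v <> d i -> pos (rf (d i) v).
Proof.
move=> pv Pv vi; case: (root_sign hPi (refl_root norm1 (d_pos i).1 pv.1)) => // h.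
have [p [q ev]] := plane_coord i Pv.
have [p0 q0] := d_span_ge0 pv ev.
have [_ q0'] : 0 <= 2 * B v (d i) - p /\ 0 <= - q.
  apply: (@d_span_ge0 i _ _ _ h).
  by rewrite /refl {1}ev; vec [:: d i; d (~~ i)].
case: vi; apply: (pos_scale hPi pv (d_pos i) (k := p)).
by rewrite ev (_ : q = 0) ?scale0r ?addr0 //; lra.
Qed.

(** Every root of the plane comes from the two canonical ones: unless it is one
    of them, its reflection inverts some [d i], and then reflecting the root in
    [d i] shortens its reflection on both sides. *)
Lemma plane_pos v : pos v -> P v -> pos2 v.
Proof.
move=> pv Pv; suff rv : root2 v by split=> //; exact: pair_cone.
elim/ltn_ind: {v}(len (rf v)) {-2}v (erefl (len (rf v))) pv Pv => n IH v vn pv Pv.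
have [[i [ri vi]]|triv] := pselect (exists i, pos (- rf v (d i)) /\ v <> d i); last first.
  have [[i ->]|nd] := pselect (exists i, v = d i).
    by apply: simple_root => //; exact: pair_set_mem.
  case: (pos_not_opp_cone hPi pv); have [p [q [p0 q0 ev]]] := d_span pv Pv.
  rewrite -(refl_self (pos_norm hPi pv)) {2}ev reflD !reflZ.
  have rp i : pos (rf v (d i)).
    case: (root_sign hPi (refl_root norm1 pv.1 (d_pos i).1)) => // h; case: triv.
    by exists i; split=> // vi; apply: nd; exists i.
  exact: (pos_comb p0 q0 (rp true) (rp false)).
have di := (d_pos i).1; pose w := - rf v (d i).
have Wv := weyl_refl norm1 pv.1; have Wi := weyl_refl norm1 di.
have vK := reflK (pos_norm hPi pv).
have e1 : rf w \o rf v = rf v \o rf (d i).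
  by apply: funext => z; rewrite /w refl_opp /= (refl_refl norm1 _ _ pv.1).
have l1 : (len (rf v \o rf (d i)) < len (rf v))%N.
  rewrite -e1; apply: (len_refl_lt hPi) => //; rewrite winv_refl ?(pos_norm hPi) //.
  by rewrite /w reflN vK opprK.
have wi : w <> d i.
  move=> e; apply: vi; apply/esym/(pos_scale hPi (d_pos i) pv (k := B (d i) v)).
  have e2 : d i = 2^-1 *: (d i + w) by rewrite e; vec [:: d i]; field.
  by rewrite [LHS]e2 /w /refl; vec [:: d i; v]; field.
have Pw : P w.
  rewrite /w /refl.
  have -> : - (d i - (2 * B (d i) v) *: v) = (- 1) *: d i + (2 * B (d i) v) *: v.
    by vec [:: d i; v].
  by apply: plane_comb => //; exact: plane_gen.
have l2 : (len (rf (d i) \o (rf v \o rf (d i))) < len (rf v \o rf (d i)))%N.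
  apply: (len_refl_lt hPi) => //; first exact: weyl_comp.
  rewrite (winv_comp norm1 Wv Wi) /= !winv_refl ?(pos_norm hPi) //.
  by rewrite -reflN; exact: plane_refl_pos.
have e2 : rf (rf (d i) v) = rf (d i) \o (rf v \o rf (d i)).
  apply: funext => z; rewrite -{1}(reflK (pos_norm hPi (d_pos i)) z).
  by rewrite (refl_refl norm1 _ _ di).
have r2 : root2 (rf (d i) v).
  apply: (IH (len (rf (rf (d i) v)))) => //; first by rewrite -vn e2; exact: ltn_trans l1.
    exact: plane_refl_pos.
  exact: plane_refl.
rewrite -(reflK (pos_norm hPi (d_pos i)) v); apply: (weyl_root norm2) => //.
by apply: (weyl_simple norm2); exact: pair_set_mem.
Qed.

Lemma pos2_d i : pos2 (d i). Proof. exact: (pos_simple hPi2 (pair_set_mem i)). Qed.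

(** The minimal representatives of the cosets of the subgroup. *)
Definition dominant (x : V -> V) := forall i, pos (winv x (d i)).

Lemma coset_decomposition x : W x ->
  exists (g u : V -> V), [/\ W2 g, W u, dominant u & x = g \o u].
Proof.
elim/ltn_ind: {x}(len x) {-2}x (erefl (len x)) => n IH x xn Wx.
have [dom|] := pselect (dominant x).
  by exists id, x; split=> //; exact: (weyl_id norm2).
move/existsNP => [i ni]; have di := (d_pos i).1.
have neg : pos (- winv x (d i)) by case: (root_sign hPi (winv_root hPi Wx (d_pos i))).
have Wy : W (rf (d i) \o x) by apply: weyl_comp => //; exact: (weyl_refl norm1).
have [|g [u [Wg Wu du e]]] := IH (len (rf (d i) \o x)) _ _ erefl Wy.
  by rewrite -xn; exact: (len_refl_lt hPi).
exists (rf (d i) \o g), u; split=> //.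
  by apply: weyl_comp => //; apply: (weyl_simple norm2); exact: pair_set_mem.
by rewrite -[LHS](refl_cancel norm1 x di) e.
Qed.

Section Coset.
Variable u : V -> V.
Hypotheses (Wu : W u) (u_dom : dominant u).

Lemma pair_W g : W2 g -> W (g \o u).
Proof. by move=> /pair_weyl[Wg _]; exact: weyl_comp. Qed.

Lemma dominant_pos v : pos2 v -> pos (winv u v).
Proof.
move=> pv; have [rv [p [q ev]]] := pair_root pv.1.
split; first exact: (weyl_root norm1 (weyl_inv norm1 Wu) rv).
have [p0 q0] := @d_span_ge0 true v p q (pair_pos pv) ev.
rewrite ev (weylD norm1 _ _ (weyl_inv norm1 Wu)) !(weylZ norm1 _ _ (weyl_inv norm1 Wu)).
exact: (pos_comb p0 q0 (u_dom true) (u_dom false)).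
Qed.

Lemma winv_coset g v : W2 g -> winv (g \o u) v = winv u (winv g v).
Proof. by move=> /pair_weyl[Wg _]; rewrite (winv_comp norm1 Wg Wu). Qed.

(** In the coset of a dominant [u], signs of roots of the plane do not see [u]:
    the ambient length and the length in the plane increase along the same
    reflections. *)
Lemma coset_pos g v : W2 g -> pos2 (winv g v) -> pos (winv (g \o u) v).
Proof. by move=> Wg /dominant_pos; rewrite winv_coset. Qed.

Lemma coset_neg g v : W2 g -> pos2 (- winv g v) -> pos (- winv (g \o u) v).
Proof.
by move=> Wg /dominant_pos; rewrite winv_coset // (weylN norm1 _ (weyl_inv norm1 Wu)).
Qed.

Lemma coset_pos_inv g v : W2 g -> pos2 v -> pos (winv (g \o u) v) -> pos2 (winv g v).
Proof.
move=> Wg pv h; case: (root_sign hPi2 (winv_root hPi2 Wg pv)) => // /(coset_neg Wg).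
by move/(pos_opp hPi h).
Qed.

Lemma coset_neg_inv g v : W2 g -> pos2 v -> pos (- winv (g \o u) v) -> pos2 (- winv g v).
Proof.
move=> Wg pv h; case: (root_sign hPi2 (winv_root hPi2 Wg pv)) => // /(coset_pos Wg).
by move=> h'; case: (pos_opp hPi h' h).
Qed.

Lemma coset_len_refl g v : W2 g -> root2 v -> (len2 g < len2 (rf v \o g))%N ->
  (len (g \o u) < len (rf v \o (g \o u)))%N.
Proof.
move=> Wg; have Wgu := pair_W Wg.
have main v' : pos2 v' -> (len2 g < len2 (rf v' \o g))%N ->
    (len (g \o u) < len (rf v' \o (g \o u)))%N.
  move=> pv /(len_gt_refl hPi2 Wg pv) h.
  by apply: (len_refl_gt hPi) => //; [exact: pair_pos|exact: coset_pos].
case/(root_sign hPi2) => pv; first exact: main.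
by rewrite -(refl_opp B v); exact: main.
Qed.

End Coset.

(** Alternating words starting with [i]; reduced words in two involutions are of
    this form, so there are at most two elements of each length. *)
Fixpoint alt i n : seq bool := if n is n'.+1 then i :: alt (~~ i) n' else [::].

Definition alt_eval i n := word_eval B [seq d j | j <- alt i n].

Lemma size_alt i n : size (alt i n) = n.
Proof. by elim: n i => //= n IH i; rewrite IH. Qed.

Lemma alt_word i n : word pair_set [seq d j | j <- alt i n].
Proof. by move=> _ /mapP[j _ ->]; exact: pair_set_mem. Qed.

Lemma alt_weyl i n : W2 (alt_eval i n).
Proof. by apply: (weyl_word norm2); exact: alt_word. Qed.

Lemma alt_len i n : (len2 (alt_eval i n) <= n)%N.
Proof.
by have := len_word B (@alt_word i n); rewrite size_map size_alt.
Qed.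

Lemma alt_evalS i n : alt_eval i n.+1 = rf (d i) \o alt_eval (~~ i) n.
Proof. by []. Qed.

Lemma alt_evalSr i n : alt_eval i n.+1 = alt_eval i n \o rf (d (i (+) odd n)).
Proof.
rewrite /alt_eval -[RHS](word_eval_cat B _ [:: _]) -(map_cat d _ [:: _]).
congr (word_eval B (map d _)); elim: n i => [|n IH] i; first by rewrite /= addbF.
by rewrite -[LHS]/(i :: alt (~~ i) n.+1) IH /=; case: i; case: odd.
Qed.

Lemma alt_evalK i n : rf (d i) \o alt_eval i n.+1 = alt_eval (~~ i) n.
Proof. by rewrite alt_evalS (refl_cancel norm1 _ (d_pos i).1). Qed.

Lemma alt_reduced g : W2 g -> exists i, g = alt_eval i (len2 g).
Proof.
move=> /(reduced_word norm2)[s [ws eg sg]].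
have [r es] : exists r, s = map d r.
  elim: s ws {eg sg} => [_|a s IH /word_cons[[i _ <-] /IH[r ->]]]; first by exists [::].
  by exists (i :: r).
suff [i er] : exists i, alt i (size r) = r.
  by exists i; rewrite -sg es size_map /alt_eval er -es.
have {ws}red : (size r <= len2 (word_eval B (map d r)))%N.
  by rewrite -es -eg -sg es size_map.
elim: r red {es sg eg s} => [_|i r IH red]; first by exists true.
rewrite map_cons word_eval_cons /= in red.
have Wr : W2 (word_eval B (map d r)).
  by apply: (weyl_word norm2) => _ /mapP[j _ ->]; exact: pair_set_mem.
have redr : (size r <= len2 (word_eval B (map d r)))%N.
  have := len_simplel norm2 (pair_set_mem i) Wr; lia.
have [j ej] := IH redr; exists i; rewrite /=.
case: r ej red {IH Wr redr} => // j' r /= [-> er] red.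
case: (eqVneq j' i) => [ji|nji]; last first.
  have eji : j' = ~~ i by case: (i) (j') nji => -[].
  by rewrite -eji /= er.
move: red; rewrite ji word_eval_cons (refl_cancel norm1 _ (d_pos i).1) => red.
have : (len2 (word_eval B (map d r)) <= size (map d r))%N.
  by apply: len_word => _ /mapP[c _ ->]; exact: pair_set_mem.
by rewrite size_map; lia.
Qed.

Lemma alt_red_peel i n : len2 (alt_eval i n.+1) = n.+1 ->
  len2 (alt_eval (~~ i) n) = n /\ len2 (alt_eval i n) = n.
Proof.
move=> red; have := len_simplel norm2 (pair_set_mem i) (alt_weyl (~~ i) n).
have := len_simpler norm2 (pair_set_mem (i (+) odd n)) (alt_weyl i n).
rewrite -alt_evalS -alt_evalSr red.
by have := alt_len (~~ i) n; have := alt_len i n; lia.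
Qed.

Lemma alt_red_lower (c : bool) n m j : len2 (alt_eval c n) = n -> (m < n)%N ->
  len2 (alt_eval j m) = m.
Proof.
elim: n c => // n IH c /alt_red_peel[r1 r2]; rewrite ltnS leq_eqVlt.
case/predU1P=> [->|]; last exact: IH r1.
by case: (eqVneq j c) => [->//|jc]; have -> : j = ~~ c by case: (j) (c) jc => -[].
Qed.

(** Two elements whose lengths in the plane are consecutive always differ by a
    reflection of the plane: their alternating words differ by a letter either at
    the left end or, when the first letters agree, at the right end. *)
Lemma coset_len_lt (u g h : V -> V) : W u -> dominant u -> W2 g -> W2 h ->
  (len2 g < len2 h)%N -> (len (g \o u) < len (h \o u))%N.
Proof.
move=> Wu du; elim/ltn_ind: {h}(len2 h) {-2}h (erefl (len2 h)) g => n IH h hn g Wg Wh gh.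
have [i eh] := alt_reduced Wh; case en: n hn eh => [|m] hn eh; rewrite hn in eh gh => //.
have red : len2 (alt_eval i m.+1) = m.+1 by rewrite -eh.
have [redl redr] := alt_red_peel red.
have hl : h = rf (d i) \o alt_eval (~~ i) m by rewrite eh.
have h_gt := coset_len_refl Wu du (alt_weyl (~~ i) m) (pos2_d i).1.
rewrite -alt_evalS red redl in h_gt.
move: gh; rewrite ltnS leq_eqVlt => /predU1P[gm|gm].
  have [j eg] := alt_reduced Wg; rewrite gm in eg.
  case: (eqVneq j i) => [ji|nji]; last first.
    have eji : j = ~~ i by case: (i) (j) nji => -[].
    by rewrite eg eji hl; exact: h_gt.
  pose v := g (d (i (+) odd m)).
  have rv : root2 v by apply: (weyl_root norm2) => //; case: (pos2_d (i (+) odd m)).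
  have e : rf v \o g = h.
    rewrite eh alt_evalSr -ji -eg; apply: funext => z.
    by rewrite /= (refl_weyl norm2 _ _ Wg) ji.
  by have := coset_len_refl Wu du Wg rv; rewrite e hn gm => /(_ (ltnSn m)); rewrite -e.
rewrite hl; apply: ltn_trans (h_gt (ltnSn m)).
by apply: (IH m) => //; [rewrite en|exact: alt_weyl|rewrite redl].
Qed.

Lemma adjacent_refl g h : W2 g -> W2 h -> len2 h = (len2 g).+1 ->
  (exists i, h = rf (d i) \o g) \/ (exists e, h = g \o rf (d e)).
Proof.
move=> Wg Wh hg; have [i eg] := alt_reduced Wg; have [c eh] := alt_reduced Wh.
rewrite hg in eh; case: (eqVneq c i) => [ci|nci].
  by right; exists (i (+) odd (len2 g)); rewrite [LHS]eh ci alt_evalSr -eg.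
left; exists c; rewrite [LHS]eh alt_evalS; congr (_ \o _); rewrite [RHS]eg; congr alt_eval.
by case: (c) (i) nci => -[].
Qed.

(** A reflection that changes the length in the plane by one is left or right
    multiplication by a generator, so its root is a wall, on one side or the other,
    of the chamber of [g]. *)
Lemma adjacent_refl_wall g v : W2 g -> pos2 v ->
  len2 (rf v \o g) = (len2 g).+1 \/ len2 g = (len2 (rf v \o g)).+1 ->
  (exists i, v = d i) \/ (exists e, winv g v = d e \/ winv g v = - d e).
Proof.
move=> Wg pv hg; have Wh : W2 (rf v \o g).
  by apply: weyl_comp => //; apply: (weyl_refl norm2); case: pv.
have : (exists i, rf v \o g = rf (d i) \o g) \/
       (exists e, rf v \o g = g \o rf (d e)).
  case: hg => [/(adjacent_refl Wg Wh)//|/(adjacent_refl Wh Wg)[[i e]|[e eg]]].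
    by left; exists i; rewrite {2}e (refl_cancel norm2 _ (pos2_d i).1).
  right; exists e; rewrite {2}eg; apply: funext => z /=.
  by rewrite (reflK (pos_norm hPi2 (pos2_d e))).
case=> [[i e]|[e eg]]; [left; exists i|right; exists e].
  apply: (pos_refl_inj hPi2 pv (pos2_d i)); apply: funext => z.
  by have := congr1 (fun f => f (winv g z)) e; rewrite /= (weylVK norm2 Wg).
have rw := winv_root hPi2 Wg pv.
have er : rf (winv g v) = rf (d e).
  apply: funext => z; have := congr1 (fun f => winv g (f z)) eg.
  rewrite /= (weylK norm2 Wg) => <-.
  by rewrite -(refl_weyl norm2 _ _ (weyl_inv norm2 Wg)) (weylK norm2 Wg).
case: (root_sign hPi2 rw) => pw; [left|right].
  exact: (pos_refl_inj hPi2 pw (pos2_d e)).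
rewrite -(pos_refl_inj hPi2 pw (pos2_d e)) ?opprK //.
by rewrite refl_opp.
Qed.

(** For [k = -1] and [k = 1] these are the inversions and the non-inversions of
    [g]; the two cases are treated together. *)
Definition sign_set k g : set V := [set v | pos2 v /\ pos2 (k *: winv g v)].

Lemma scaled_winv_inj k g v w : W2 g -> k != 0 ->
  k *: winv g v = k *: winv g w -> v = w.
Proof.
move=> Wg k0 /(scalerI k0) e.
by rewrite -[v](weylVK norm2 Wg) e (weylVK norm2 Wg).
Qed.

(** A wall is an extremal ray, either of the positive roots or of their image
    under [g], up to the sign [k]. *)
Lemma wall_not_between k g v : W2 g -> k != 0 -> sign_set k g v ->
  (exists i, v = d i) \/ (exists e, k *: winv g v = d e) ->
  ~ between (sign_set k g) v.
Proof.
move=> Wg k0 [pv kv] wall [b [c [p [q [[[pb kb] [pc kc] bv cv] [p0 q0 ev]]]]]].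
case: wall => [[i vi]|[e ve]].
  rewrite vi in ev bv cv.
  by case: (simple_indecomposable hPi2 (pair_set_mem i) pb pc p0 q0 ev).
have Wg' := weyl_inv norm2 Wg.
have ew : d e = p *: (k *: winv g b) + q *: (k *: winv g c).
  rewrite -ve ev (weylD norm2 _ _ Wg') !(weylZ norm2 _ _ Wg').
  by vec [:: winv g b; winv g c].
case: (simple_indecomposable hPi2 (pair_set_mem e) kb kc p0 q0 ew); rewrite -ve.
  by move/(scaled_winv_inj Wg k0).
by move/(scaled_winv_inj Wg k0).
Qed.

(** Write [v] in the basis formed by the two walls. A negative coefficient at [c]
    contradicts that [d i] is extremal, and one at [d i] contradicts, after
    applying the inverse of [g], that [d e] is. *)
Lemma walls_span k g i e (c v : V) : W2 g -> k != 0 -> sign_set k g (d i) ->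
  sign_set k g c -> k *: winv g c = d e -> d i <> c ->
  sign_set k g v -> v <> d i -> v <> c ->
  exists p q, [/\ 0 <= p, 0 <= q & v = p *: d i + q *: c].
Proof.
move=> Wg k0 [pi ki] [pc kc] ce ic [pv kv] vi vc.
have [s [t ec]] := plane_coord i (pair_root pc.1).2.
have t0 : t != 0.
  apply/eqP => t0; apply: ic; apply/esym/(pos_scale hPi2 pc pi (k := s)).
  by rewrite ec t0 scale0r addr0.
have [p' [q' ev']] := plane_coord i (pair_root pv.1).2.
have [p [q ev]] : exists p q, v = p *: d i + q *: c.
  exists (p' - q' / t * s), (q' / t).
  by rewrite ev' ec; vec [:: d i; d (~~ i)]; field.
have Wg' := weyl_inv norm2 Wg.
exists p, q; split=> //; rewrite leNgt; apply/negP => neg.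
  apply: vc; apply: (scaled_winv_inj Wg k0); rewrite ce.
  apply: (pos_extremal hPi2 (pair_set_mem e) kv
    (w := (- p) *: (k *: winv g (d i))) _ (k := q)).
    by apply: coneZ; [rewrite oppr_ge0 ltW|case: ki].
  rewrite -ce {1}ev (weylD norm2 _ _ Wg') !(weylZ norm2 _ _ Wg').
  by vec [:: winv g (d i); winv g c].
apply: vi; apply: (pos_extremal hPi2 (pair_set_mem i) pv (w := (- q) *: c) _ (k := p)).
  by apply: coneZ; [rewrite oppr_ge0 ltW|case: pc].
by rewrite {1}ev; vec [:: d i; c].
Qed.

(** The two walls are obtained from the alternating word of [g] by deleting its
    first and its last letter; when these deletions give the same element, [g] has
    a shorter word. *)
Lemma descend_between g v : W2 g -> sign_set (- 1) g v ->
  ((len2 (rf v \o g)).+1 < len2 g)%N ->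
  exists b c p q, [/\ sign_set (- 1) g b, sign_set (- 1) g c, 0 <= p, 0 <= q &
    v = p *: b + q *: c] /\
    (len2 (rf v \o g) < len2 (rf b \o g))%N /\
    (len2 (rf v \o g) < len2 (rf c \o g))%N.
Proof.
move=> Wg Av; have [i eg] := alt_reduced Wg; move: eg.
have [m en] : exists m, len2 g = m.+1.
  have : (0 < len2 g)%N by case: Av => pv; rewrite scaleN1r => /(len_refl_lt hPi2 Wg pv); lia.
  by case: (len2 g) => // m; exists m.
rewrite en => eg vm; rewrite ltnS in vm.
have red : len2 (alt_eval i m.+1) = m.+1 by rewrite -eg.
have [redl redr] := alt_red_peel red.
have bE : rf (d i) \o g = alt_eval (~~ i) m by rewrite eg alt_evalK.
have Ab : sign_set (- 1) g (d i).
  split; first exact: pos2_d.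
  by rewrite scaleN1r; apply: (len_lt_refl hPi2 Wg (pos2_d i)); rewrite bE redl en.
pose e := i (+) odd m; pose c := alt_eval i m (d e).
have Wg1 := alt_weyl i m.
have rc : root2 c by apply: (weyl_root norm2) => //; case: (pos2_d e).
have cE : rf c \o g = alt_eval i m.
  apply: funext => z; rewrite eg alt_evalSr /= (refl_weyl norm2 _ _ Wg1).
  by rewrite (reflK (pos_norm hPi2 (pos2_d e))).
have cw : winv g c = - d e.
  have We : W2 (rf (d e)) by apply: (weyl_simple norm2); exact: pair_set_mem.
  rewrite eg alt_evalSr (winv_comp norm2 Wg1 We) /= /c (weylK norm2 Wg1).
  by rewrite winv_refl ?(refl_self (pos_norm hPi2 (pos2_d e))) ?(pos_norm hPi2 (pos2_d e)).
have pc : pos2 c.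
  case: (root_sign hPi2 rc) => // nc.
  have : pos2 (- winv g (- c)).
    by apply: (len_lt_refl hPi2 Wg nc); rewrite refl_opp cE redr en.
  by rewrite (weylN norm2 _ (weyl_inv norm2 Wg)) opprK cw => /(pos_opp hPi2 (pos2_d e)).
have ce : (- 1) *: winv g c = d e by rewrite cw scaleN1r opprK.
have Ac : sign_set (- 1) g c by split=> //; rewrite ce; exact: pos2_d.
have ic : d i <> c.
  move=> ic; have := cE; rewrite -ic bE => ee.
  case: m en eg vm red redl redr bE @e @c Wg1 rc cE cw pc ce Ac ic ee => // m.
  move=> _ _ _ red _ _ _ _ _ _ _ _ _ _ _ _ _ ee.
  have : len2 (alt_eval i m.+2) = len2 (alt_eval (~~ i) m).
    by rewrite alt_evalS ee alt_evalK.
  by rewrite red; have := alt_len (~~ i) m; lia.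
have N1 : - 1 != 0 :> R by rewrite oppr_eq0 oner_eq0.
have vi : v <> d i by move=> vi; move: vm; rewrite vi bE redl ltnn.
have vc : v <> c by move=> vc; move: vm; rewrite vc cE redr ltnn.
have [p [q [p0 q0 ev]]] := walls_span Wg N1 Ab Ac ce ic Av vi vc.
by exists (d i), c, p, q; split=> //; rewrite bE cE redl redr.
Qed.

(** Dually, the alternating word of [g] is extended by one letter on either
    side; both extensions are reduced because some element is longer by at least
    two. *)
Lemma ascend_between g v : W2 g -> sign_set 1 g v ->
  ((len2 g).+1 < len2 (rf v \o g))%N ->
  exists b c p q, [/\ sign_set 1 g b, sign_set 1 g c, 0 <= p, 0 <= q &
    v = p *: b + q *: c] /\
    (len2 (rf b \o g) < len2 (rf v \o g))%N /\
    (len2 (rf c \o g) < len2 (rf v \o g))%N.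
Proof.
move=> Wg Av vn; have [i eg] := alt_reduced Wg; set n := len2 g in eg vn.
have Wh : W2 (rf v \o g).
  by apply: weyl_comp => //; apply: (weyl_refl norm2); case: Av => -[].
have [j eh] := alt_reduced Wh.
have red m l : (m <= n.+1)%N -> len2 (alt_eval l m) = m.
  by move=> mn; apply: (@alt_red_lower j (len2 (rf v \o g))); rewrite -?eh //; lia.
have bE : rf (d (~~ i)) \o g = alt_eval (~~ i) n.+1 by rewrite eg alt_evalS negbK.
have Ab : sign_set 1 g (d (~~ i)).
  split; first exact: pos2_d.
  by rewrite scale1r; apply: (len_gt_refl hPi2 Wg (pos2_d _)); rewrite bE red.
pose e := i (+) odd n; pose c := g (d e).
have rc : root2 c by apply: (weyl_root norm2) => //; case: (pos2_d e).
have cE : rf c \o g = alt_eval i n.+1.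
  by rewrite alt_evalSr -eg; apply: funext => z /=; rewrite (refl_weyl norm2 _ _ Wg).
have cw : winv g c = d e by rewrite /c (weylK norm2 Wg).
have pc : pos2 c.
  case: (root_sign hPi2 rc) => // nc.
  have : pos2 (winv g (- c)).
    by apply: (len_gt_refl hPi2 Wg nc); rewrite refl_opp cE red.
  by rewrite (weylN norm2 _ (weyl_inv norm2 Wg)) cw => /(pos_opp hPi2 (pos2_d e)).
have ce : 1 *: winv g c = d e by rewrite scale1r.
have Ac : sign_set 1 g c by split=> //; rewrite ce; exact: pos2_d.
have ic : d (~~ i) <> c.
  move=> ic; have := cE; rewrite -ic bE => ee.
  have {}ee l : alt_eval (~~ l) n.+1 = alt_eval l n.+1.
    by case: (i) (l) ee => -[] //= ->.
  have [l redl] : exists l, len2 (alt_eval l n.+2) = n.+2.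
    case: (ltngtP n.+2 (len2 (rf v \o g))) => h; last 2 first.
    - by move: vn; rewrite ltnNge -ltnS h.
    - by exists j; rewrite h -eh.
    by exists j; apply: (@alt_red_lower j (len2 (rf v \o g))); rewrite -?eh.
  have : len2 (alt_eval l n.+2) = len2 (alt_eval (~~ l) n).
    by rewrite alt_evalS ee alt_evalK.
  by rewrite redl; have := alt_len (~~ l) n; lia.
have vi : v <> d (~~ i) by move=> vi; move: vn; rewrite vi bE red // ltnn.
have vc : v <> c by move=> vc; move: vn; rewrite vc cE red // ltnn.
have [p [q [p0 q0 ev]]] := walls_span Wg (oner_neq0 R) Ab Ac ce ic Av vi vc.
by exists (d (~~ i)), c, p, q; split=> //; rewrite bE cE !red.
Qed.

Lemma between_not_adjacent k g v : W2 g -> k = 1 \/ k = - 1 ->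
  sign_set k g v -> between (sign_set k g) v ->
  len2 (rf v \o g) <> (len2 g).+1 /\ len2 g <> (len2 (rf v \o g)).+1.
Proof.
move=> Wg k1 Av bt; suff nadj : ~ (len2 (rf v \o g) = (len2 g).+1 \/
    len2 g = (len2 (rf v \o g)).+1) by split=> e; apply: nadj; [left|right].
move=> adj; have k0 : k != 0 by case: k1 => ->; rewrite ?oppr_eq0 oner_eq0.
apply: wall_not_between bt => //; have [pv kv] := Av.
case: (adjacent_refl_wall Wg pv adj) => [|[e ve]]; first by left.
right; exists e; have opp_e : ~ pos2 (- d e) := pos_opp hPi2 (pos2_d e).
case: k1 ve kv => -> [] ->; rewrite ?scale1r ?scaleN1r ?opprK //.
Qed.

Lemma coset_inversions u g v : W u -> dominant u -> W2 g -> P v ->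
  inversions B Pi (g \o u) v <-> sign_set (- 1) g v.
Proof.
move=> Wu du Wg Pv; split.
  move=> /(inversionsP hPi _ (pair_W Wu Wg))[pv nv]; have pv2 := plane_pos pv Pv.
  by split=> //; rewrite scaleN1r; exact: coset_neg_inv nv.
move=> [pv]; rewrite scaleN1r => nv; apply/(inversionsP hPi _ (pair_W Wu Wg)).
by split; [exact: pair_pos|exact: coset_neg nv].
Qed.

Lemma coset_noninversions u g v : W u -> dominant u -> W2 g -> P v ->
  noninversions B Pi (g \o u) v <-> sign_set 1 g v.
Proof.
move=> Wu du Wg Pv; split.
  move=> /(noninversionsP hPi _ (pair_W Wu Wg))[pv nv]; have pv2 := plane_pos pv Pv.
  by split=> //; rewrite scale1r; exact: coset_pos_inv nv.
move=> [pv]; rewrite scale1r => nv; apply/(noninversionsP hPi _ (pair_W Wu Wg)).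
by split; [exact: pair_pos|exact: coset_pos nv].
Qed.

Lemma between_sub (A A' : set V) v : A `<=` A' -> between A v -> between A' v.
Proof.
move=> AA' [b [c [p [q [[Ab Ac bv cv] h]]]]].
by exists b, c, p, q; split=> //; split=> //; exact: AA'.
Qed.

Lemma sign_set_plane k g v : sign_set k g v -> P v.
Proof. by case=> -[/pair_root[]]. Qed.

(** Not being a wall, [v] changes the length in the plane by more than one, so
    it lies in the cone of two walls, which change it by exactly one; by
    monotonicity in the coset, the ambient lengths compare in the same way. *)
Lemma plane_inversion_step x v : W x -> P v -> inversions B Pi x v ->
  between (inversions B Pi x `&` P) v ->
  exists b c p q, [/\ inversions B Pi x b, inversions B Pi x c, 0 <= p, 0 <= q &
    v = p *: b + q *: c] /\
    (len (rf v \o x) < len (rf b \o x))%N /\ (len (rf v \o x) < len (rf c \o x))%N.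
Proof.
move=> Wx Pv xv bt; have [g [u [Wg Wu du ex]]] := coset_decomposition Wx.
rewrite ex in xv bt *; have inE w := @coset_inversions u g w Wu du Wg.
have Av := (inE v Pv).1 xv.
have bt2 : between (sign_set (- 1) g) v.
  by apply: between_sub bt => w [iw Pw]; exact/inE.
have W2r w : sign_set (- 1) g w -> W2 (rf w \o g).
  by move=> [[rw _] _]; apply: weyl_comp => //; exact: (weyl_refl norm2).
have [_ nadj] := between_not_adjacent Wg (or_intror erefl) Av bt2.
have gap : ((len2 (rf v \o g)).+1 < len2 g)%N.
  rewrite ltn_neqAle; apply/andP; split; first by apply/eqP => /esym.
  by case: Av => pv; rewrite scaleN1r; exact: (len_refl_lt hPi2 Wg pv).
have [b [c [p [q [[Ab Ac p0 q0 ev] [lb lc]]]]]] := descend_between Wg Av gap.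
exists b, c, p, q; split.
  have [Pb Pc] := (sign_set_plane Ab, sign_set_plane Ac).
  by split=> //; exact/inE.
split; first exact: (coset_len_lt Wu du (W2r v Av) (W2r b Ab) lb).
exact: (coset_len_lt Wu du (W2r v Av) (W2r c Ac) lc).
Qed.

Lemma plane_noninversion_step x v : W x -> P v -> noninversions B Pi x v ->
  between (noninversions B Pi x `&` P) v \/
  between (inversions B Pi (rf v \o x) `&` P) v ->
  exists b c p q, [/\ noninversions B Pi x b, noninversions B Pi x c, 0 <= p, 0 <= q &
    v = p *: b + q *: c] /\
    (len (rf b \o x) < len (rf v \o x))%N /\ (len (rf c \o x) < len (rf v \o x))%N.
Proof.
move=> Wx Pv xv bt; have [g [u [Wg Wu du ex]]] := coset_decomposition Wx.
rewrite ex in xv bt *; have inE w := @coset_noninversions u g w Wu du Wg.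
have Av := (inE v Pv).1 xv.
have W2r w : sign_set 1 g w -> W2 (rf w \o g).
  by move=> [[rw _] _]; apply: weyl_comp => //; exact: (weyl_refl norm2).
have Wh := W2r v Av; have rv : root2 v by case: Av => -[].
have gap : ((len2 g).+1 < len2 (rf v \o g))%N.
  rewrite ltn_neqAle; apply/andP; split; last first.
    by case: Av => pv; rewrite scale1r; exact: (len_refl_gt hPi2 Wg pv).
  apply/eqP => /esym adj; case: bt => bt.
    have bt2 : between (sign_set 1 g) v.
      by apply: between_sub bt => w [iw Pw]; exact/inE.
    by have [] := between_not_adjacent Wg (or_introl erefl) Av bt2.
  have inhE w := @coset_inversions u (rf v \o g) w Wu du Wh.
  have bt2 : between (sign_set (- 1) (rf v \o g)) v.
    by apply: between_sub bt => w [iw Pw]; exact/inhE.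
  have Ahv : sign_set (- 1) (rf v \o g) v.
    case: Av => pv kv; split=> //; move: kv; rewrite scale1r scaleN1r.
    rewrite (winv_refl_comp norm2 _ rv Wg) (refl_self (pos_norm hPi2 pv)).
    by rewrite (weylN norm2 _ (weyl_inv norm2 Wg)) opprK.
  have [_] := between_not_adjacent Wh (or_intror erefl) Ahv bt2.
  by rewrite (refl_cancel norm2 _ rv).
have [b [c [p [q [[Ab Ac p0 q0 ev] [lb lc]]]]]] := ascend_between Wg Av gap.
exists b, c, p, q; split.
  have [Pb Pc] := (sign_set_plane Ab, sign_set_plane Ac).
  by split=> //; exact/inE.
split; first exact: (coset_len_lt Wu du (W2r b Ab) (W2r v Av) lb).
exact: (coset_len_lt Wu du (W2r c Ac) (W2r v Av) lc).
Qed.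

End Dihedral.

(** * Closures *)
Section Closure.
Variables (R : realType) (V : lmodType R) (B : {symmetric V}) (Pi : set V).
Hypothesis hPi : root_basis B Pi.
Implicit Types (u v w : V) (p q : R) (x : V -> V).

Local Notation rf := (refl B).
Local Notation W := (weyl B Pi).
Local Notation len := (len B Pi).
Local Notation pos := (pos_roots B Pi).
Let norm1 := basis_norm hPi.

Lemma between_plane (A : set V) v : A `<=` pos -> pos v -> between A v ->
  exists d : bool -> V, [/\ forall i, pos (d i), d true <> d false,
    forall w, pos w -> plane (d true) (d false) w ->
      exists s t : R, [/\ 0 <= s, 0 <= t & w = s *: d true + t *: d false],
    plane (d true) (d false) v & between (A `&` plane (d true) (d false)) v].
Proof.
move=> Apos pv [b [c [p [q [[Ab Ac bv cv] [p0 q0 ev]]]]]].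
have bc : b <> c.
  move=> bc; apply: bv; apply/esym/(pos_scale hPi pv (Apos _ Ab) (k := p + q)).
  by rewrite ev -bc; vec [:: b].
have [d [g [[pd pg dg pb pc] span]]] := plane_basis hPi (Apos _ Ab) (Apos _ Ac) bc.
exists (fun i : bool => if i then d else g); split=> //=.
- by case.
- by rewrite ev; exact: plane_comb.
by exists b, c, p, q; split.
Qed.

(** The strict inequalities serve twice: they make the decomposition of an
    inversion terminate, and, since inversions decrease length, they show that an
    inversion lying between two others cannot decrease it by one only. *)
Lemma inversion_step x v : W x -> inversions B Pi x v -> between (inversions B Pi x) v ->
  exists b c p q, [/\ inversions B Pi x b, inversions B Pi x c, 0 <= p, 0 <= q &
    v = p *: b + q *: c] /\
    (len (rf v \o x) < len (rf b \o x))%N /\ (len (rf v \o x) < len (rf c \o x))%N.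
Proof.
move=> Wx xv; have sub : inversions B Pi x `<=` pos by move=> w [].
move=> /(between_plane sub xv.1)[d [dp dn ds Pv]].
exact: (plane_inversion_step hPi dp dn ds).
Qed.

(** The second alternative is the form in which [inversion_between], applied to
    [rf v \o x], provides the plane. *)
Lemma noninversion_step x v : W x -> noninversions B Pi x v ->
  between (noninversions B Pi x) v \/ between (inversions B Pi (rf v \o x)) v ->
  exists b c p q, [/\ noninversions B Pi x b, noninversions B Pi x c, 0 <= p, 0 <= q &
    v = p *: b + q *: c] /\
    (len (rf b \o x) < len (rf v \o x))%N /\ (len (rf c \o x) < len (rf v \o x))%N.
Proof.
move=> Wx xv [] bt.
  have sub : noninversions B Pi x `<=` pos by move=> w [].
  have [d [dp dn ds Pv btP]] := between_plane sub xv.1 bt.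
  by apply: (plane_noninversion_step hPi dp dn ds) => //; left.
have sub : inversions B Pi (rf v \o x) `<=` pos by move=> w [].
have [d [dp dn ds Pv btP]] := between_plane sub xv.1 bt.
by apply: (plane_noninversion_step hPi dp dn ds) => //; right.
Qed.

Lemma inversion_len x v : W x -> inversions B Pi x v -> (len (rf v \o x) < len x)%N.
Proof. by move=> Wx /(inversionsP hPi _ Wx)[pv]; exact: len_refl_lt. Qed.

Lemma noninversion_len x v : W x -> noninversions B Pi x v ->
  (len x < len (rf v \o x))%N.
Proof. by move=> Wx /(noninversionsP hPi _ Wx)[pv]; exact: len_refl_gt. Qed.

Lemma winv_comb x u v p q : W x ->
  winv x (p *: u + q *: v) = p *: winv x u + q *: winv x v.
Proof.
move=> /(weyl_inv norm1) Wx'.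
by rewrite (weylD norm1 _ _ Wx') !(weylZ norm1 _ _ Wx').
Qed.

Lemma inversions_closed x : W x -> two_closed B Pi (inversions B Pi x).
Proof.
move=> Wx; split=> [v [[]]//|u v].
move=> /(inversionsP hPi _ Wx)[pu nu] /(inversionsP hPi _ Wx)[pv nv] s t s0 t0 r.
apply/(inversionsP hPi _ Wx); split; first by split=> //; exact: (pos_comb s0 t0 pu pv).
have := pos_comb s0 t0 nu nv; rewrite !scalerN -opprD -winv_comb // => c.
by split=> //; apply: (root_opp norm1); apply: (weyl_root norm1) => //; exact: weyl_inv.
Qed.

Lemma noninversions_closed x : W x -> two_closed B Pi (noninversions B Pi x).
Proof.
move=> Wx; split=> [v [[]]//|u v].
move=> /(noninversionsP hPi _ Wx)[pu nu] /(noninversionsP hPi _ Wx)[pv nv] s t s0 t0 r.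
apply/(noninversionsP hPi _ Wx); split; first by split=> //; exact: (pos_comb s0 t0 pu pv).
have := pos_comb s0 t0 nu nv; rewrite -winv_comb // => c.
by split=> //; apply: (weyl_root norm1) => //; exact: weyl_inv.
Qed.

(** If some [v] in [E] were missing from [G], then [A] without [v] would still be
    closed and contain [G]. *)
Lemma closure_eqP (A E G : set V) : two_closed B Pi A -> E `<=` A ->
  (forall v, E v -> ~ between A v) ->
  (forall H, two_closed B Pi H -> E `<=` H -> A `<=` H) ->
  two_closure B Pi G = A <-> E `<=` G /\ G `<=` A.
Proof.
move=> clA EA ext gen; split=> [eA|[EG GA]].
  split; last by rewrite -eA; exact: sub_gen_smallest.
  move=> v Ev; apply: contrapT => nGv; have := EA v Ev; rewrite -eA.
  move=> /(_ (A `\ v)) /=; case=> //.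
  split; last first.
    move=> w Gw; split=> /=; last by move=> wv; apply: nGv; rewrite -wv.
    by rewrite -eA; exact: sub_gen_smallest.
  split=> [w [/clA.1]//|u w [Au uv] [Aw wv] s t s0 t0 r].
  split; first by apply: clA.2.
  move=> /= e; apply: (ext v Ev).
  by exists u, w, s, t; split.
apply/seteqP; split; first exact: smallest_sub.
move=> v Av H [clH GH]; apply: gen Av => //; exact: subset_trans GH.
Qed.

(** Generation is by induction on the drop in length. *)
Lemma inversions_closure x (G : set V) : W x ->
  two_closure B Pi G = inversions B Pi x <->
  len_shift_roots B Pi x (- 1) `<=` G /\ G `<=` inversions B Pi x.
Proof.
move=> Wx; apply: closure_eqP; first exact: inversions_closed.
- move=> v [pv lv]; apply/(inversionsP hPi _ Wx); split=> //.
  by apply: (len_lt_refl hPi Wx pv); lia.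
- move=> v [pv lv] bt; have iv : inversions B Pi x v.
    by apply/(inversionsP hPi _ Wx); split=> //; apply: (len_lt_refl hPi Wx pv); lia.
  have [b [c [p [q [[ib _ _ _ _] [lb _]]]]]] := inversion_step Wx iv bt.
  by have := inversion_len Wx ib; lia.
move=> H clH EH v; move em: (len x - len (rf v \o x))%N => m.
elim/ltn_ind: m v em => m IH v em iv; have lv := inversion_len Wx iv.
case: (ltnP (len (rf v \o x)).+1 (len x)) => lv'; last first.
  by apply: EH; split; [case: iv|lia].
have bt := inversion_between hPi Wx iv lv'.
have [b [c [p [q [[ib ic p0 q0 ev] [lb lc]]]]]] := inversion_step Wx iv bt.
have lb' := inversion_len Wx ib; have lc' := inversion_len Wx ic.
rewrite ev; apply: clH.2 => //; last by rewrite -ev; case: iv => -[].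
- by apply: (IH _ _ b erefl ib); lia.
- by apply: (IH _ _ c erefl ic); lia.
Qed.

(** Generation is by induction on the length of [rf v \o x]. *)
Lemma noninversions_closure x (G : set V) : W x ->
  two_closure B Pi G = noninversions B Pi x <->
  len_shift_roots B Pi x 1 `<=` G /\ G `<=` noninversions B Pi x.
Proof.
move=> Wx; apply: closure_eqP; first exact: noninversions_closed.
- move=> v [pv lv]; apply/(noninversionsP hPi _ Wx); split=> //.
  by apply: (len_gt_refl hPi Wx pv); lia.
- move=> v [pv lv] bt; have iv : noninversions B Pi x v.
    by apply/(noninversionsP hPi _ Wx); split=> //; apply: (len_gt_refl hPi Wx pv); lia.
  have [b [c [p [q [[ib _ _ _ _] [lb _]]]]]] := noninversion_step Wx iv (or_introl bt).
  by have := noninversion_len Wx ib; lia.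
move=> H clH EH v; move em: (len (rf v \o x)) => m.
elim/ltn_ind: m v em => m IH v em iv; have lv := noninversion_len Wx iv.
case: (ltnP (len x).+1 (len (rf v \o x))) => lv'; last first.
  by apply: EH; split; [case: iv|lia].
have rv := iv.1.1; have Wvx : W (rf v \o x).
  by apply: (weyl_comp norm1) => //; exact: (weyl_refl norm1).
have ivx : inversions B Pi (rf v \o x) v.
  have [pv nv] := (noninversionsP hPi _ Wx).1 iv.
  apply/(inversionsP hPi _ Wvx); split=> //.
  rewrite (winv_refl_comp norm1 _ rv Wx) (refl_self (pos_norm hPi pv)).
  by rewrite (weylN norm1 _ (weyl_inv norm1 Wx)) opprK.
have bt : between (inversions B Pi (rf v \o x)) v.
  by apply: (inversion_between hPi Wvx ivx); rewrite (refl_cancel norm1 _ rv).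
have [b [c [p [q [[ib ic p0 q0 ev] [lb lc]]]]]] := noninversion_step Wx iv (or_intror bt).
rewrite ev; apply: clH.2 => //; last by rewrite -ev.
- by apply: (IH _ _ b erefl ib); lia.
- by apply: (IH _ _ c erefl ic); lia.
Qed.

End Closure.

Theorem lemma1p7 (R : realType) (V : lmodType R) (B : {symmetric V})
    (Pi : set V) (hPi : simple_roots B Pi)
    (Gamma : set V) (hGamma : Gamma `<=` pos_roots B Pi)
    (x : V -> V) (hx : weyl B Pi x) :
  (two_closure B Pi Gamma = inversions B Pi x <->
     len_shift_roots B Pi x (-1) `<=` Gamma /\ Gamma `<=` inversions B Pi x) /\
  (two_closure B Pi Gamma = noninversions B Pi x <->
     len_shift_roots B Pi x 1 `<=` Gamma /\ Gamma `<=` noninversions B Pi x).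
Proof.
have hB := simple_roots_basis hPi.
by split; [exact: inversions_closure|exact: noninversions_closure].
Qed.
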